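(* Let $n=2$ and let $a\in C(\mathbb{T}^2,(0,\infty))$. Then $\partial S_a$ does not contain a line segment of irrational slope. Equivalently, $\partial D_a$ is differentiable at every irrational point, i.e. at every $x\in\partial D_a$ that is not a real multiple of a vector in $\mathbb{Z}^2$ the convex set $D_a$ has a unique supporting line.
   Context: $\mathbb{T}^2=\mathbb{R}^2/\mathbb{Z}^2$; functions on $\mathbb{T}^2$ are identified with $\mathbb{Z}^2$-periodic functions on $\mathbb{R}^2$. For $a\in C(\mathbb{T}^2,(0,\infty))$ and $p\in\mathbb{R}^2$, the effective Hamiltonian $\overline H_a(p)$ is the unique constant such that the cell problem $a(y)|p+Dv(y)|=\overline H_a(p)$ in $\mathbb{T}^2$ has a continuous $\mathbb{Z}^2$-periodic viscosity solution $v$; equivalently $\overline H_a(p)=\inf_{\phi\in C^1(\mathbb{T}^2)}\max_{y\in\mathbb{T}^2}a(y)|p+D\phi(y)|$. $\overline H_a$ is convex, even and positively $1$-homogeneous. Set $S_a=\{p\in\mathbb{R}^2:\overline H_a(p)\le1\}$ and $D_a=\partial\overline H_a(0)$ (the subdifferential of $\overline H_a$ at $0$, called the effective front). A line segment in $\mathbb{R}^2$ has irrational slope if its direction vector is not a real multiple of a vector in $\mathbb{Z}^2$. *)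

(* Defs.v *)
From Stdlib Require Import Reals ZArith.
From Coquelicot Require Import Coquelicot.
Open Scope R_scope.

Definition periodic2 (f : R -> R -> R) : Prop :=
  forall x y, f (x + 1) y = f x y /\ f x (y + 1) = f x y.

Definition admissible_coeff (a : R -> R -> R) : Prop :=
  (forall x y, continuity_2d_pt a x y) /\ (forall x y, 0 < a x y) /\ periodic2 a.

Definition C1_periodic (phi d1 d2 : R -> R -> R) : Prop :=
  periodic2 phi /\
  (forall x y, differentiable_pt_lim phi x y (d1 x y) (d2 x y)) /\
  (forall x y, continuity_2d_pt d1 x y) /\
  (forall x y, continuity_2d_pt d2 x y).

Definition norm2 (u v : R) : R := sqrt (u * u + v * v).

(* H_a(p) = inf_{phi in C^1(T^2)} max_y a(y) |p + Dphi(y)|,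
   written as the infimum of all m that bound a(y)|p + Dphi(y)| for some phi
   (inf over phi of the max = inf of all such upper bounds). *)
Definition effH (a : R -> R -> R) (p1 p2 : R) : R :=
  real (Glb_Rbar (fun m => exists phi d1 d2, C1_periodic phi d1 d2 /\
          forall x y, a x y * norm2 (p1 + d1 x y) (p2 + d2 x y) <= m)).

Definition S_a (a : R -> R -> R) (p1 p2 : R) : Prop := effH a p1 p2 <= 1.

Definition in_boundary (E : R -> R -> Prop) (p1 p2 : R) : Prop :=
  forall eps, 0 < eps ->
    (exists q1 q2, E q1 q2 /\ norm2 (q1 - p1) (q2 - p2) < eps) /\
    (exists r1 r2, ~ E r1 r2 /\ norm2 (r1 - p1) (r2 - p2) < eps).

Definition irrational_dir (v1 v2 : R) : Prop :=
  ~ exists (c : R) (k1 k2 : Z), v1 = c * IZR k1 /\ v2 = c * IZR k2.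

(* Main.v *)
Require Import Defs.
From Stdlib Require Import Reals ZArith Lra Lia Classical ClassicalEpsilon List.
From Coquelicot Require Import Coquelicot.
Open Scope R_scope.

(** Write [b = 1/a], let [p1], [p2] be the ends of the segment, [v = p2 - p1] and [p] the
    midpoint. Take almost optimal subsolutions [u1 = p1.z + periodic], [u2 = p2.z + periodic]
    and their mean [w]. Since there is no strict subsolution at [p], there are arbitrarily long
    discrete curves ("chains") along which [w], hence both [u1] and [u2], grows at
    almost the maximal rate; so [f = u2 - u1] is almost constant along such a chain, while
    [f(z + k) = f(z) + v.k] for integer vectors [k]. If [A], [y], [B] are successive points of
    the chain, then for every [z] near [y]
      [f(z) - f(y) <= d(A,z) + d(z,B) - d(A,B) + small],
    and as the chain is almost straight at small scales, this is [o(|z - y|)]. Now translate the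
    chain by the multiples of an integer vector [k0] for which [v.k0] is positive and small, which
    exists because [v] is irrational. In the plane all these translates cross one common
    bounded transversal, so by pigeonhole two of them come so close to each other that the
    difference of their values of [f], at least [v.k0], violates that bound. *)

(** * Chains and calibration *)

Definition dot (p z : C) : R := fst p * fst z + snd p * snd z.

Definition lat (i j : Z) : C := (IZR i, IZR j).

Lemma dot_plus_r p z w : dot p (z + w)%C = dot p z + dot p w.
Proof. unfold dot; simpl; ring. Qed.

Lemma dot_minus_r p z w : dot p (z - w)%C = dot p z - dot p w.
Proof. unfold dot; simpl; ring. Qed.

Lemma Cmod_sqr z : Cmod z * Cmod z = fst z * fst z + snd z * snd z.
Proof. pose proof (Cmod2_alt z) as H; unfold Re, Im in H; simpl in H; nra. Qed.

Lemma dot_le p z : dot p z <= Cmod p * Cmod z.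
Proof.
  pose proof (Cmod_sqr p); pose proof (Cmod_sqr z).
  pose proof (Cmod_ge_0 p); pose proof (Cmod_ge_0 z).
  unfold dot; apply Rsqr_incr_0_var; [unfold Rsqr|nra].
  replace (Cmod p * Cmod z * (Cmod p * Cmod z))
    with ((Cmod p * Cmod p) * (Cmod z * Cmod z)) by ring.
  rewrite H, H0.
  pose proof (Rle_0_sqr (fst p * snd z - snd p * fst z)); unfold Rsqr in *; nra.
Qed.

Lemma Cmod_minus_sym z w : Cmod (z - w)%C = Cmod (w - z)%C.
Proof. rewrite <- Cmod_opp; f_equal; ring. Qed.

Lemma dot_abs_le p z : Rabs (dot p z) <= Cmod p * Cmod z.
Proof.
  apply Rabs_le; split; [|apply dot_le].
  pose proof (dot_le p (- z)%C) as H; rewrite Cmod_opp in H.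
  unfold dot in *; simpl in H; lra.
Qed.

Lemma Cmod_dist_triangle x y z :
  Cmod (x - z)%C <= Cmod (x - y)%C + Cmod (y - z)%C.
Proof. replace (x - z)%C with ((x - y) + (y - z))%C by ring; apply Cmod_triangle. Qed.

Lemma Cmod_self z : Cmod (z - z)%C = 0.
Proof. replace (z - z)%C with (RtoC 0) by ring; apply Cmod_0. Qed.

Lemma Cmod_le_abs z : Cmod z <= Rabs (fst z) + Rabs (snd z).
Proof.
  apply Rsqr_incr_0_var; [unfold Rsqr|];
    pose proof (Rabs_pos (fst z)); pose proof (Rabs_pos (snd z)); [|lra].
  rewrite Cmod_sqr.
  assert (forall t, t * t = Rabs t * Rabs t) as E
    by (intro; rewrite <- Rabs_mult; symmetry; apply Rabs_pos_eq; nra).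
  rewrite (E (fst z)), (E (snd z)); nra.
Qed.

(** A discrete curve with steps at most [r], indexed by its endpoint and its cost, a Riemann sum for
    the integral of [b] along the curve. Each step is charged at its starting point, so that
    increment bounds of the form [m * b z * Cmod (z' - z)] add up along a chain. *)
Inductive chain (b : C -> R) (r : R) (z : C) : C -> R -> Prop :=
| chain_nil : chain b r z z 0
| chain_step y y' L : chain b r z y L -> Cmod (y' - y)%C <= r ->
    chain b r z y' (L + b y * Cmod (y' - y)%C).

Lemma chain_app b r x y z L1 L2 :
  chain b r x y L1 -> chain b r y z L2 -> chain b r x z (L1 + L2).
Proof.
  intros H1 H2; induction H2 as [|w w' L H2 IH Hs].
  - rewrite Rplus_0_r; exact H1.
  - rewrite <- Rplus_assoc; now apply chain_step.
Qed.

Lemma chain_ge0 b r x y L : (forall z, 0 < b z) -> chain b r x y L -> 0 <= L.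
Proof.
  intros Hb H; induction H as [|w w' L H IH Hs]; [lra|].
  pose proof (Hb w); pose proof (Cmod_ge_0 (w' - w)%C); nra.
Qed.

Lemma chain_translate b r k x y L : (forall z, b (z + k)%C = b z) ->
  chain b r x y L -> chain b r (x + k)%C (y + k)%C L.
Proof.
  intros Hk H; induction H as [|w w' L H IH Hs]; [constructor|].
  replace (w' - w)%C with ((w' + k) - (w + k))%C in * by ring.
  rewrite <- (Hk w); now apply chain_step.
Qed.

(** Discrete intermediate value argument: walk back from [y] until [P] fails; it must fail at [x] at
    the latest. *)
Lemma chain_crossing b r (P : C -> Prop) x y L :
  chain b r x y L -> ~ P x -> P y ->
  exists c c' L1 L2, chain b r x c L1 /\ ~ P c /\ Cmod (c' - c)%C <= r /\ P c' /\
    chain b r c' y L2 /\ L = L1 + b c * Cmod (c' - c)%C + L2.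
Proof.
  intros H Hx; induction H as [|w w' L H IH Hs]; intros Hy; [tauto|].
  destruct (classic (P w)) as [Hw|Hw].
  - destruct (IH Hw) as (c & c' & L1 & L2 & H1 & H2 & H3 & H4 & H5 & ->).
    exists c, c', L1, (L2 + b w * Cmod (w' - w)%C); repeat split; auto.
    + now apply chain_step.
    + ring.
  - exists w, w', L, 0; repeat split; auto; [constructor|ring].
Qed.

Lemma chain_upper b r m (u : C -> R) x y L :
  (forall z z', Cmod (z' - z)%C <= r -> u z' - u z <= m * b z * Cmod (z' - z)%C) ->
  chain b r x y L -> u y - u x <= m * L.
Proof.
  intros Hu H; induction H as [|w w' L H IH Hs]; [lra|].
  specialize (Hu _ _ Hs); nra.
Qed.

(** The truncation at [rho] allows chains that leave the ball where [beta] bounds [b]. A step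
    starting farther than [2 * rho] from [c] ends outside the ball of radius [rho], so it does not
    change the truncated distance. *)
Lemma chain_lower b r rho beta c x y L :
  0 <= r <= rho -> 0 <= beta ->
  (forall z, 0 < b z) ->
  (forall z, Cmod (z - c)%C <= 2 * rho -> beta <= b z) ->
  chain b r x y L ->
  beta * Rabs (Rmin (Cmod (y - c)%C) rho - Rmin (Cmod (x - c)%C) rho) <= L.
Proof.
  intros Hr Hbeta Hpos Hb H; induction H as [|w w' L H IH Hs].
  - rewrite Rminus_diag, Rabs_R0; lra.
  - set (d := Cmod (w - c)%C) in *; set (d' := Cmod (w' - c)%C) in *.
    set (d0 := Rmin (Cmod (x - c)%C) rho) in *.
    pose proof (Cmod_dist_triangle w' w c) as T1; pose proof (Cmod_dist_triangle w w' c) as T2.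
    rewrite (Cmod_minus_sym w w') in T2; fold d d' in T1, T2.
    set (e := Cmod (w' - w)%C) in *.
    assert (0 <= e) by apply Cmod_ge_0.
    assert (beta * Rabs (Rmin d' rho - Rmin d rho) <= b w * e) as Hstep.
    { destruct (Rle_dec d (2 * rho)) as [Hd|Hd].
      - pose proof (Hb w Hd).
        assert (Rabs (Rmin d' rho - Rmin d rho) <= e).
        { unfold Rmin; do 2 destruct Rle_dec; apply Rabs_le; lra. }
        pose proof (Rabs_pos (Rmin d' rho - Rmin d rho)); nra.
      - rewrite !Rmin_right by lra. rewrite Rminus_diag, Rabs_R0.
        pose proof (Hpos w); nra. }
    replace (Rmin d' rho - d0) with ((Rmin d' rho - Rmin d rho) + (Rmin d rho - d0)) by ring.
    pose proof (Rabs_triang (Rmin d' rho - Rmin d rho) (Rmin d rho - d0)); nra.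
Qed.

(** Equivalently, [u] is the sum of the linear function [dot p] and a periodic function. *)
Definition quasi (p : C) (u : C -> R) : Prop :=
  forall z i j, u (z + lat i j)%C = u z + dot p (lat i j).

(** Discrete form of a subsolution of the cell problem at [p] with right-hand side [m < 1]; no
    smoothness is asked of [V], since averaging will supply it. *)
Definition strict_sub (b : C -> R) (p : C) : Prop :=
  exists V m r, quasi p V /\ 0 < m < 1 /\ 0 < r /\
   forall z z', Cmod (z' - z)%C <= r -> V z' - V z <= m * b z * Cmod (z' - z)%C.

(** Greedy cutting: a block is closed as soon as its cost exceeds [M]. One step costs at most
    [r * B <= 1], so every closed block has cost in [[M, M + 1]] and gains at most the rate [g]; the
    open block is the remainder [L2]. *)
Lemma chain_split_bound b r B M g G (w : C -> R) :
  (forall z, 0 < b z <= B) -> 0 < M -> 0 <= r -> r * B <= 1 -> 0 <= g -> 0 <= G ->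
  (forall x y L, chain b r x y L -> w y - w x <= G * L) ->
  (forall x y L, chain b r x y L -> M <= L <= M + 1 -> w y - w x <= g * L) ->
  forall x y L, chain b r x y L ->
  exists c L1 L2, chain b r x c L1 /\ chain b r c y L2 /\ L = L1 + L2 /\ L2 <= M /\
    w c - w x <= g * L1.
Proof.
  intros Hb HM Hr HrB Hg HG Hw Hs x y L H; induction H as [|y y' L H IH Hy].
  - exists x, 0, 0; repeat split; try constructor; lra.
  - destruct IH as (c & L1 & L2 & H1 & H2 & -> & H3 & H4).
    assert (Hst := chain_step b r c y y' L2 H2 Hy).
    set (e := b y * Cmod (y' - y)%C) in *.
    assert (0 <= e <= 1).
    { pose proof (Hb y) as [? ?]; pose proof (Cmod_ge_0 (y' - y)%C); unfold e; split; [nra|].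
      apply Rle_trans with (B * r); [apply Rmult_le_compat; lra|lra]. }
    destruct (Rle_dec (L2 + e) M) as [Hle|Hgt].
    + exists c, L1, (L2 + e); repeat split; auto; lra.
    + exists y', (L1 + (L2 + e)), 0; repeat split; try lra.
      * eapply chain_app; eauto.
      * constructor.
      * assert (w y' - w c <= g * (L2 + e)) by (apply (Hs _ _ _ Hst); lra). lra.
Qed.

(* [V y = inf (w x + (1 - eta) L)] over all chains from [x] to [y] of cost [L]: if no
   long chain were nearly calibrated, this would be a strict subsolution. *)
Lemma calibrated_chain b B p w G r M eta :
  (forall z, 0 < b z <= B) -> (forall z i j, b (z + lat i j)%C = b z) ->
  quasi p w -> 0 < r -> r * B <= 1 -> 0 < M -> 0 < eta < 1 -> 0 <= G ->
  (forall z z', Cmod (z' - z)%C <= r -> w z' - w z <= G * b z * Cmod (z' - z)%C) ->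
  ~ strict_sub b p ->
  exists x y L, chain b r x y L /\ M <= L <= M + 1 /\ (1 - eta) * L <= w y - w x.
Proof.
  intros Hb Hper Hq Hr HrB HM Heta HG Hw Hns; apply NNPP; intro Hno; apply Hns.
  assert (Hs : forall x y L, chain b r x y L -> M <= L <= M + 1 ->
      w y - w x <= (1 - eta) * L).
  { intros x y L Hc HL; apply Rnot_lt_le; intro; apply Hno; exists x, y, L; repeat split; auto; lra. }
  assert (HG' : forall x y L, chain b r x y L -> w y - w x <= G * L).
  { intros; eapply chain_upper; eauto. }
  (* This bounds the infimum defining [V] from below: closed blocks gain at most the rate [1 - eta],
     and the remainder of cost at most [M] contributes at most [G * M]. *)
  assert (Hlow : forall x y L, chain b r x y L -> w y - G * M <= w x + (1 - eta) * L).
  { intros x y L Hc.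
    destruct (chain_split_bound b r B M (1 - eta) G w) with (x := x) (y := y) (L := L)
      as (c & L1 & L2 & H1 & H2 & -> & H3 & H4); auto; try lra.
    pose proof (HG' _ _ _ H2).
    assert (0 <= L2) by (eapply chain_ge0; [|eauto]; intro; apply Hb). nra. }
  set (E := fun y t => exists x L, chain b r x y L /\ t = w x + (1 - eta) * L).
  assert (Hinf : forall y, { v : R | (forall t, E y t -> v <= t) /\
      (forall v', (forall t, E y t -> v' <= t) -> v' <= v) }).
  { intro y.
    destruct (completeness (fun s => E y (- s))) as [s [Hs1 Hs2]].
    - exists (- (w y - G * M)); intros s (x & L & Hc & He). pose proof (Hlow _ _ _ Hc); lra.
    - exists (- w y), y, 0; split; [constructor|ring].
    - exists (- s); split.
      + intros t Ht. assert (- t <= s); [|lra]. apply Hs1; now rewrite Ropp_involutive.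
      + intros v' Hv'. assert (s <= - v'); [|lra]. apply Hs2; intros s' Hs'.
        specialize (Hv' _ Hs'); lra. }
  set (V := fun y => proj1_sig (Hinf y)).
  assert (HV1 : forall y t, E y t -> V y <= t) by (intro y; apply (proj2_sig (Hinf y))).
  assert (HV2 : forall y v', (forall t, E y t -> v' <= t) -> v' <= V y)
    by (intro y; apply (proj2_sig (Hinf y))).
  exists V, (1 - eta), r; split; [|split; [lra|split; [auto|]]].
  (* Chains can be translated by lattice vectors, which gives one inequality; the same inequality at
     [z + lat i j] with the opposite vector gives the other. *)
  - assert (Hle : forall z i j, V (z + lat i j)%C <= V z + dot p (lat i j)).
    { intros z i j. assert (V (z + lat i j)%C - dot p (lat i j) <= V z); [|lra].
      apply HV2; intros t (x & L & Hc & ->).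
      assert (V (z + lat i j)%C <= w (x + lat i j)%C + (1 - eta) * L).
      { apply HV1; exists (x + lat i j)%C, L; split; auto.
        apply chain_translate; auto. }
      rewrite Hq in H; lra. }
    intros z i j; apply Rle_antisym; [apply Hle|].
    pose proof (Hle (z + lat i j)%C (- i)%Z (- j)%Z) as H.
    replace (z + lat i j + lat (- i) (- j))%C with z in H.
    + unfold dot, lat in *; simpl in *; rewrite !opp_IZR in H; lra.
    + unfold lat; rewrite !opp_IZR. destruct z; unfold Cplus; simpl; f_equal; ring.
  (* Appending the step from [z] to [z'] to a competitor for [V z] yields a competitor for
     [V z']. *)
  - intros z z' Hz.
    assert (V z' - (1 - eta) * b z * Cmod (z' - z)%C <= V z); [|lra].
    apply HV2; intros t (x & L & Hc & ->).
    assert (V z' <= w x + (1 - eta) * (L + b z * Cmod (z' - z)%C)); [|lra].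
    apply HV1; exists x, (L + b z * Cmod (z' - z)%C); split; auto.
    now apply chain_step.
Qed.

(** * Integrated subsolutions and flatness along a calibrated chain *)

(* Integrated form of [|Du| <= m b]. *)
Definition level (b : C -> R) (m : R) (u : C -> R) : Prop :=
  forall z z' beta, (forall t, 0 <= t <= 1 -> b (z + RtoC t * (z' - z))%C <= beta) ->
    u z' - u z <= m * beta * Cmod (z' - z)%C.

Lemma level_ball b m u c rho beta z z' :
  level b m u -> (forall x, Cmod (x - c)%C <= rho -> b x <= beta) ->
  Cmod (z - c)%C <= rho -> Cmod (z' - c)%C <= rho ->
  u z' - u z <= m * beta * Cmod (z' - z)%C.
Proof.
  intros Hu Hb Hz Hz'; apply Hu; intros t Ht; apply Hb.
  replace (z + RtoC t * (z' - z) - c)%C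
    with (RtoC (1 - t) * (z - c) + RtoC t * (z' - c))%C
    by (rewrite RtoC_minus; ring).
  eapply Rle_trans; [apply Cmod_triangle|]. rewrite !Cmod_mult, !Cmod_R, !Rabs_pos_eq by lra.
  pose proof (Cmod_ge_0 (z - c)%C); pose proof (Cmod_ge_0 (z' - c)%C); nra.
Qed.

Lemma nearest_translate z z' : exists i j, Cmod (z' + lat i j - z)%C <= 2.
Proof.
  destruct z as [x y], z' as [x' y'].
  exists (up (x - x')), (up (y - y')).
  eapply Rle_trans; [apply Cmod_le_abs|]; simpl.
  destruct (archimed (x - x')), (archimed (y - y')).
  rewrite !Rabs_pos_eq; lra.
Qed.

(** The left-hand side is unchanged when [z'] moves by a lattice vector, so [z'] may be taken within
    distance 2 of [z], where the Lipschitz constant [2 * B] is enough. *)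
Lemma level_osc b B p m u : 0 < B -> (forall z, b z <= B) -> quasi p u -> level b m u -> 0 <= m <= 2 ->
  forall z z', Rabs (u z' - u z - dot p (z' - z)%C) <= 4 * B + 2 * Cmod p.
Proof.
  intros HB Hb Hq Hu Hm.
  assert (Hlip : forall z z', u z' - u z <= 2 * B * Cmod (z' - z)%C).
  { intros z z'. apply Rle_trans with (m * B * Cmod (z' - z)%C); [apply Hu; auto|].
    pose proof (Cmod_ge_0 (z' - z)%C). apply Rmult_le_compat_r; nra. }
  intros z z'. destruct (nearest_translate z z') as (i & j & Hd).
  assert (E : u z' - u z - dot p (z' - z)%C
     = u (z' + lat i j)%C - u z - dot p (z' + lat i j - z)%C).
  { rewrite Hq, !dot_minus_r, dot_plus_r; ring. }
  rewrite E; set (k := (z' + lat i j)%C) in *.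
  pose proof (Hlip z k); pose proof (Hlip k z) as H1; rewrite (Cmod_minus_sym z k) in H1.
  pose proof (dot_abs_le p (k - z)%C) as H2; apply Rabs_le_between in H2.
  pose proof (Cmod_ge_0 (k - z)%C). pose proof (Cmod_ge_0 p).
  assert (Cmod p * Cmod (k - z)%C <= Cmod p * 2) by (apply Rmult_le_compat_l; lra).
  assert (2 * B * Cmod (k - z)%C <= 2 * B * 2) by (apply Rmult_le_compat_l; lra).
  apply Rabs_le; lra.
Qed.

Lemma parallelogram (w A B : C) :
  2 * (Cmod (w - A)%C * Cmod (w - A)%C) + 2 * (Cmod (w - B)%C * Cmod (w - B)%C)
  = Cmod (w + w - A - B)%C * Cmod (w + w - A - B)%C + Cmod (A - B)%C * Cmod (A - B)%C.
Proof. rewrite !Cmod_sqr; simpl; ring. Qed.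

(* Moving the middle point [y] of a nearly straight triple by [delta] lengthens the
   broken line only to second order. *)
Lemma broken_line_excess A B y z r delta omega :
  let S := Cmod (y - A)%C + Cmod (y - B)%C in
  0 < S -> 0 <= omega <= 1 / 10 ->
  Rabs (Cmod (y - A)%C - Cmod (y - B)%C) <= r ->
  (1 - 5 * omega) * S <= Cmod (A - B)%C -> Cmod (z - y)%C <= delta ->
  Cmod (z - A)%C + Cmod (z - B)%C
  <= S + (8 * (delta * delta) + 2 * (r * r) + 20 * omega * (S * S)) / (2 * S).
Proof.
  intros S HS Hom Hr HD Hz.
  (* At [y] the parallelogram law shows that [y] is close to the midpoint of [A] and [B], because
     [y] is nearly equidistant from them and [D] is nearly [S]. Hence [z] is close to the midpoint
     too, and the law at [z] bounds [X + Y]. *)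
  pose proof (parallelogram z A B) as Pz; pose proof (parallelogram y A B) as Py.
  assert (HQ : Cmod (z + z - A - B)%C <= 2 * Cmod (z - y)%C + Cmod (y + y - A - B)%C).
  { replace (z + z - A - B)%C with ((z - y) + ((z - y) + (y + y - A - B)))%C by ring.
    pose proof (Cmod_triangle (z - y) ((z - y) + (y + y - A - B)))%C.
    pose proof (Cmod_triangle (z - y) (y + y - A - B))%C. lra. }
  assert (HDS : Cmod (A - B)%C <= S).
  { unfold S; pose proof (Cmod_dist_triangle A y B).
    rewrite (Cmod_minus_sym A y) in *; lra. }
  pose proof (Cmod_ge_0 (z + z - A - B)%C); pose proof (Cmod_ge_0 (y + y - A - B)%C).
  pose proof (Cmod_ge_0 (z - y)%C); pose proof (Cmod_ge_0 (z - A)%C); pose proof (Cmod_ge_0 (z - B)%C).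
  set (X := Cmod (z - A)%C) in *; set (Y := Cmod (z - B)%C) in *.
  set (Q := Cmod (z + z - A - B)%C) in *; set (q := Cmod (y + y - A - B)%C) in *.
  set (D := Cmod (A - B)%C) in *; set (al := Cmod (y - A)%C) in *; set (ga := Cmod (y - B)%C) in *.
  set (d := Cmod (z - y)%C) in *.
  set (e := 8 * (delta * delta) + 2 * (r * r) + 20 * omega * (S * S)).
  apply Rabs_le_between in Hr.
  assert (Hr2 : (al - ga) * (al - ga) <= r * r) by nra.
  assert (HD2 : (1 - 10 * omega) * (S * S) <= D * D).
  { assert (0 <= (1 - 5 * omega) * S) by (apply Rmult_le_pos; lra).
    apply Rle_trans with (((1 - 5 * omega) * S) * ((1 - 5 * omega) * S)); [|nra].
    assert (0 <= omega * omega * (S * S)) by (repeat apply Rmult_le_pos; lra). nra. }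
  assert (Hq2 : q * q <= r * r + 10 * omega * (S * S)) by (unfold S in *; nra).
  assert (HQ2 : Q * Q <= 8 * (delta * delta) + 2 * (q * q)).
  { assert (Q * Q <= (2 * d + q) * (2 * d + q)) by (apply Rmult_le_compat; lra).
    assert (d * d <= delta * delta) by (apply Rmult_le_compat; lra).
    pose proof (Rle_0_sqr (2 * d - q)); unfold Rsqr in *; nra. }
  assert (HXY : (X + Y) * (X + Y) <= S * S + e).
  { assert (D * D <= S * S) by (apply Rmult_le_compat; unfold D; auto using Cmod_ge_0).
    pose proof (Rle_0_sqr (X - Y)); unfold Rsqr, e in *; nra. }
  assert (He : 0 <= e / (2 * S)).
  { apply Rle_mult_inv_pos; [|lra]. unfold e.
    assert (0 <= omega * (S * S)) by (repeat apply Rmult_le_pos; lra).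
    pose proof (Rle_0_sqr delta); pose proof (Rle_0_sqr r); unfold Rsqr in *; lra. }
  (* The square root of [S * S + e] is at most [S + e / (2 * S)], as squaring shows. *)
  apply Rsqr_incr_0_var; unfold Rsqr; [|lra].
  replace ((S + e / (2 * S)) * (S + e / (2 * S)))
    with (S * S + e + (e / (2 * S)) * (e / (2 * S))) by (field; lra).
  nra.
Qed.

(** No particular chain is named: the condition covers every way of joining [x0] to [x1] through [c]
    and [d] at total cost [L]. Thus it applies to any piece cut out by [chain_crossing] without
    tracking points of the chain. *)
Definition calibrated b r x0 x1 L kappa (u : C -> R) : Prop :=
  forall c d l1 l2 l3, chain b r x0 c l1 -> chain b r c d l2 -> chain b r d x1 l3 ->
    l1 + l2 + l3 = L -> l2 - 2 * kappa <= u d - u c.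

(** The flatness of [f = uq - up] near a chain point [y]. The increase of [uq] is bounded through a
    point [A] before [y], the decrease of [up] through a point [B] after [y]; together they cost the
    excess of the broken line [A], [z], [B] over [A], [y], [B]. At scale [K * delta] this excess is
    of order [delta / K]. *)
Lemma calibrated_flat b r x0 x1 L1 L2 kappa m up uq y z K delta rho omega :
  (forall z, 0 < b z) -> level b m up -> level b m uq ->
  chain b r x0 y L1 -> chain b r y x1 L2 ->
  calibrated b r x0 x1 (L1 + L2) kappa up -> calibrated b r x0 x1 (L1 + L2) kappa uq ->
  1 <= K -> 0 < omega -> 96 * omega * (K * K) <= 1 -> 1 <= m <= 1 + omega ->
  0 < r <= delta -> (K + 1) * delta <= rho ->
  (forall x, Cmod (x - y)%C <= 2 * rho -> b x <= (1 + omega) * b y /\ b y <= (1 + omega) * b x) ->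
  0 <= kappa -> kappa <= omega * (K * delta) * b y ->
  K * delta <= Cmod (x0 - y)%C -> K * delta <= Cmod (x1 - y)%C -> Cmod (z - y)%C <= delta ->
  (uq z - up z) - (uq y - up y) <= 6 * b y * delta / K + 4 * kappa.
Proof.
  intros Hpos Hp Hq Hc1 Hc2 Hcp Hcq HK Hom HomK Hm Hr Hrho Hvar Hk0 Hk Hx0 Hx1 Hz.
  set (s := K * delta) in *.
  assert (Hs : delta <= s) by (unfold s; nra).
  pose proof (Hpos y) as Hby; set (be := b y) in *.
  assert (Hom1 : omega <= 1 / 96).
  { assert (omega * 1 <= omega * (K * K)) by (apply Rmult_le_compat_l; nra). lra. }
  (* [A] and [B] are points of the chain before and after [y] where it crosses the circle of radius
     [s] about [y]; their distances to [y] lie between [s] and [s + r]. *)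
  destruct (chain_crossing b r (fun c => Cmod (c - y)%C < s) _ _ _ Hc1)
    as (A & A' & l1 & l2 & HA1 & HA2 & HA3 & HA4 & HA5 & HA6); [lra|rewrite Cmod_self; lra|].
  destruct (chain_crossing b r (fun c => s <= Cmod (c - y)%C) _ _ _ Hc2)
    as (B' & B & l3 & l4 & HB1 & HB2 & HB3 & HB4 & HB5 & HB6);
    [rewrite Cmod_self; lra|exact Hx1|].
  assert (HAy : chain b r A y (b A * Cmod (A' - A)%C + l2)).
  { eapply chain_app; [|exact HA5]. rewrite <- (Rplus_0_l (b A * _)).
    apply chain_step; [constructor|auto]. }
  assert (HyB : chain b r y B (l3 + b B' * Cmod (B - B')%C)) by now apply chain_step.
  set (La := b A * Cmod (A' - A)%C + l2) in *.
  set (Lb := l3 + b B' * Cmod (B - B')%C) in *.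
  assert (HrA : s <= Cmod (y - A)%C <= s + r).
  { rewrite (Cmod_minus_sym y A). pose proof (Cmod_dist_triangle A A' y).
    rewrite (Cmod_minus_sym A A') in *; lra. }
  assert (HrB : s <= Cmod (y - B)%C <= s + r).
  { rewrite (Cmod_minus_sym y B). pose proof (Cmod_dist_triangle B B' y). lra. }
  assert (Hlow : forall x, Cmod (x - y)%C <= 2 * rho -> (1 - omega) * be <= b x).
  { intros x Hx. destruct (Hvar x Hx) as [_ H]. pose proof (Hpos x). fold be in H. nra. }
  assert (Hrr : s + r <= rho) by (unfold s in *; lra).
  assert (HLa : (1 - omega) * be * Cmod (y - A)%C <= La).
  { pose proof (chain_lower b r rho ((1 - omega) * be) y A y La) as H.
    rewrite Cmod_self, (Cmod_minus_sym A y), !Rmin_left, Rabs_minus_sym, Rminus_0_r, Rabs_pos_eq in H by lra.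
    apply H; auto; [lra|apply Rmult_le_pos; lra]. }
  assert (HLb : (1 - omega) * be * Cmod (y - B)%C <= Lb).
  { pose proof (chain_lower b r rho ((1 - omega) * be) y y B Lb) as H.
    rewrite Cmod_self, (Cmod_minus_sym B y), !Rmin_left, Rminus_0_r, Rabs_pos_eq in H by lra.
    apply H; auto; [lra|apply Rmult_le_pos; lra]. }
  assert (Hup : forall u w w', level b m u -> Cmod (w - y)%C <= rho -> Cmod (w' - y)%C <= rho ->
     u w' - u w <= (1 + 3 * omega) * be * Cmod (w' - w)%C).
  { intros u w w' Hu Hw Hw'.
    apply Rle_trans with (m * ((1 + omega) * be) * Cmod (w' - w)%C).
    - apply (level_ball b m u y rho); auto. intros x Hx; apply Hvar; lra.
    - apply Rmult_le_compat_r; [apply Cmod_ge_0|].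
      assert (m * (1 + omega) <= 1 + 3 * omega) by nra. nra. }
  (* [Dq] and [Dp], with [U1] and [U2] below, yield the bound on [f]; [Dab], with [U3], serves only
     to show that [A], [y], [B] are almost aligned. *)
  assert (Dq : La - 2 * kappa <= uq y - uq A) by (apply (Hcq A y l1 La L2); auto; unfold La; lra).
  assert (Dp : Lb - 2 * kappa <= up B - up y) by (apply (Hcp y B L1 Lb l4); auto; unfold Lb in *; lra).
  assert (Dab : La + Lb - 2 * kappa <= up B - up A).
  { apply (Hcp A B l1 (La + Lb) l4); auto; [eapply chain_app; eauto|unfold La, Lb in *; lra]. }
  assert (HA : Cmod (A - y)%C <= rho) by (rewrite Cmod_minus_sym; lra).
  assert (HB : Cmod (B - y)%C <= rho) by (rewrite Cmod_minus_sym; lra).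
  pose proof (Hup uq A z Hq HA ltac:(lra)) as U1.
  pose proof (Hup up z B Hp ltac:(lra) HB) as U2.
  pose proof (Hup up A B Hp HA HB) as U3.
  rewrite (Cmod_minus_sym B z) in U2; rewrite (Cmod_minus_sym B A) in U3.
  set (S := Cmod (y - A)%C + Cmod (y - B)%C).
  assert (HSs : 2 * s <= S <= 4 * s) by (unfold S; lra).
  assert (HS0 : 0 < S) by lra.
  assert (HD : (1 - 5 * omega) * S <= Cmod (A - B)%C).
  { set (D := Cmod (A - B)%C) in *.
    assert (H1 : (1 - omega) * be * S - 2 * (omega * s * be) <= (1 + 3 * omega) * be * D)
      by (unfold S; lra).
    assert (H2 : be * ((1 - 2 * omega) * S) <= be * ((1 + 3 * omega) * D)).
    { assert (omega * be * (2 * s) <= omega * be * S) by (apply Rmult_le_compat_l; [apply Rmult_le_pos; lra|lra]). lra. }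
    apply Rmult_le_reg_l in H2; [|auto].
    apply Rmult_le_reg_l with (1 + 3 * omega); [lra|].
    assert (0 <= omega * omega * S) by (repeat apply Rmult_le_pos; lra). lra. }
  pose proof (broken_line_excess A B y z r delta omega HS0 ltac:(lra)) as HX.
  fold S in HX. specialize (HX ltac:(apply Rabs_le; lra) HD Hz).
  set (XY := Cmod (z - A)%C + Cmod (z - B)%C) in *.
  assert (Hrd : r * r <= delta * delta) by (apply Rmult_le_compat; lra).
  set (e := 8 * (delta * delta) + 2 * (r * r) + 20 * omega * (S * S)) in *.
  (* The main term is [5 * delta^2 / S], and [S >= 2 * K * delta]. *)
  assert (HE : e / (2 * S) <= 5 * delta / (2 * K) + 10 * omega * S).
  { apply Rle_trans with ((10 * (delta * delta) + 20 * omega * (S * S)) / (2 * S)).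
    - apply Rmult_le_compat_r; [left; apply Rinv_0_lt_compat; lra|unfold e; lra].
    - replace ((10 * (delta * delta) + 20 * omega * (S * S)) / (2 * S))
        with (5 * (delta * delta) / S + 10 * omega * S) by (field; lra).
      apply Rplus_le_compat_r. apply Rmult_le_reg_r with (S * (2 * K)); [apply Rmult_lt_0_compat; lra|].
      replace (5 * (delta * delta) / S * (S * (2 * K))) with (5 * delta * (2 * s)) by (unfold s; field; lra).
      replace (5 * delta / (2 * K) * (S * (2 * K))) with (5 * delta * S) by (field; lra).
      apply Rmult_le_compat_l; lra. }
  assert (He0 : 0 <= e / (2 * S)).
  { apply Rle_mult_inv_pos; [|lra]. unfold e.
    assert (0 <= omega * (S * S)) by (repeat apply Rmult_le_pos; lra).
    pose proof (Rle_0_sqr delta); pose proof (Rle_0_sqr r); unfold Rsqr in *; lra. }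
  (* The geometric excess contributes [5 * delta / K]. The errors from the variation of [b] total
     [24 * omega * S <= 96 * omega * s], at most [delta / K] by the choice of [omega]. *)
  assert (Hfin : (1 + 3 * omega) * XY - (1 - omega) * S <= 6 * delta / K).
  { apply Rle_trans with ((1 + 3 * omega) * (S + e / (2 * S)) - (1 - omega) * S).
    - assert ((1 + 3 * omega) * XY <= (1 + 3 * omega) * (S + e / (2 * S)))
        by (apply Rmult_le_compat_l; lra). lra.
    - assert ((1 + 3 * omega) * (e / (2 * S)) <= 2 * (e / (2 * S))) by (apply Rmult_le_compat_r; lra).
      assert (omega * S <= omega * (4 * s)) by (apply Rmult_le_compat_l; lra).
      assert (96 * omega * s <= delta / K).
      { apply Rmult_le_reg_r with K; [lra|]. replace (delta / K * K) with delta by (field; lra).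
        unfold s. replace (96 * omega * (K * delta) * K) with (96 * omega * (K * K) * delta) by ring.
        rewrite <- (Rmult_1_l delta) at 2. apply Rmult_le_compat_r; lra. }
      assert (2 * (5 * delta / (2 * K)) = 5 * (delta / K)) by (field; lra).
      replace (6 * delta / K) with (6 * (delta / K)) by (field; lra). lra. }
  assert (Hb6 : be * ((1 + 3 * omega) * XY - (1 - omega) * S) <= be * (6 * delta / K))
    by (apply Rmult_le_compat_l; lra).
  replace (6 * be * delta / K) with (be * (6 * delta / K)) by (field; lra).
  unfold XY, S in Hb6. lra.
Qed.

(** * Lattice values of an irrational functional *)

(** If no two values were close, the index of the cell of length [h] would be injective from [N + 1]
    indices into [N] cells. *)
Lemma pigeonhole_real (N : nat) (g : nat -> R) (lo h : R) : 0 < h ->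
  (forall j, (j <= N)%nat -> lo <= g j < lo + INR N * h) ->
  exists i j, (i < j <= N)%nat /\ Rabs (g i - g j) < h.
Proof.
  intros Hh Hg; apply NNPP; intro Hno.
  set (cell := fun j => Z.to_nat (Int_part ((g j - lo) / h))).
  assert (Hip : forall j, (j <= N)%nat -> (0 <= Int_part ((g j - lo) / h) < Z.of_nat N)%Z /\
     IZR (Int_part ((g j - lo) / h)) <= (g j - lo) / h < IZR (Int_part ((g j - lo) / h)) + 1).
  { intros j Hj; destruct (Hg j Hj) as [H1 H2].
    destruct (base_Int_part ((g j - lo) / h)) as [H3 H4].
    assert (0 <= (g j - lo) / h) by (apply Rle_mult_inv_pos; lra).
    assert ((g j - lo) / h < INR N).
    { apply Rmult_lt_reg_r with h; [lra|]. replace ((g j - lo) / h * h) with (g j - lo) by (field; lra). lra. }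
    split; [split|lra].
    - apply le_IZR. assert (-1 < Int_part ((g j - lo) / h))%Z; [apply lt_IZR; lra|apply IZR_le; lia].
    - apply lt_IZR; rewrite <- INR_IZR_INZ; lra. }
  assert (Hnd : NoDup (map cell (seq 0 (S N)))).
  { apply NoDup_map_NoDup_ForallPairs; [|apply seq_NoDup].
    intros i j Hi Hj Hij. apply in_seq in Hi, Hj.
    assert (Heq : forall i j, (i < j <= N)%nat -> cell i = cell j -> False).
    { clear i j Hi Hj Hij; intros i j Hl He; apply Hno; exists i, j; split; [auto|].
      destruct (Hip i ltac:(lia)) as [Hi1 Hi2], (Hip j ltac:(lia)) as [Hj1 Hj2].
      assert (E : Int_part ((g i - lo) / h) = Int_part ((g j - lo) / h)) by (unfold cell in He; lia).
      rewrite E in Hi2.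
      replace (g i - g j) with (((g i - lo) / h - (g j - lo) / h) * h) by (field; lra).
      rewrite Rabs_mult, (Rabs_pos_eq h) by lra.
      apply Rlt_le_trans with (1 * h); [|lra]. apply Rmult_lt_compat_r; [lra|]. apply Rabs_def1; lra. }
    destruct (lt_eq_lt_dec i j) as [[H|H]|H]; auto; exfalso.
    - apply (Heq i j); [lia|auto].
    - apply (Heq j i); [lia|auto]. }
  assert (Hinc : incl (map cell (seq 0 (S N))) (seq 0 N)).
  { intros x Hx; apply in_map_iff in Hx as (j & <- & Hj); apply in_seq in Hj; apply in_seq.
    destruct (Hip j ltac:(lia)) as [H _]; unfold cell; lia. }
  pose proof (NoDup_incl_length Hnd Hinc) as H; rewrite length_map, !length_seq in H; lia.
Qed.

(** Dirichlet's argument: two of the fractional parts of [j * v1 / v2] differ by less than [1 / N],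
    so some lattice value is smaller than [theta] in absolute value. Irrationality makes it nonzero,
    and a change of sign makes it positive. *)
Lemma small_lattice_value (v : C) : irrational_dir (fst v) (snd v) ->
  forall theta, 0 < theta -> exists i j, 0 < dot v (lat i j) < theta.
Proof.
  destruct v as [v1 v2]; simpl; intros Hirr theta Ht.
  assert (Hv2 : v2 <> 0).
  { intros ->; apply Hirr; exists v1, 1%Z, 0%Z; lra. }
  assert (Hnz : forall k1 k2, (k1 <> 0)%Z -> v1 * IZR k1 + v2 * IZR k2 <> 0).
  { intros k1 k2 Hk H; apply Hirr; exists (v2 / IZR k1), (- k2)%Z, k1.
    assert (IZR k1 <> 0) by (now apply not_0_IZR).
    rewrite opp_IZR; split; field_simplify_eq; auto; lra. }
  destruct (nfloor_ex (Rabs v2 / theta)) as (N0 & _ & HN).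
  { apply Rle_mult_inv_pos; [apply Rabs_pos|auto]. }
  set (N := S N0). assert (HNpos : 0 < INR N) by (apply lt_0_INR; unfold N; lia).
  assert (HN' : Rabs v2 / INR N < theta).
  { apply Rmult_lt_reg_r with (INR N / theta); [apply Rdiv_lt_0_compat; auto|].
    replace (Rabs v2 / INR N * (INR N / theta)) with (Rabs v2 / theta) by (field; lra).
    replace (theta * (INR N / theta)) with (INR N) by (field; lra).
    unfold N; rewrite S_INR; lra. }
  destruct (pigeonhole_real N (fun j => frac_part (v1 * INR j / v2)) 0 (/ INR N))
    as (i & j & Hij & Hd).
  - now apply Rinv_0_lt_compat.
  - intros j _; destruct (base_fp (v1 * INR j / v2)).
    rewrite Rinv_r by lra; lra.
  - unfold frac_part in Hd.
    set (n := (Int_part (v1 * INR i / v2) - Int_part (v1 * INR j / v2))%Z).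
    set (m := (Z.of_nat i - Z.of_nat j)%Z).
    assert (E : v1 * IZR m + v2 * IZR (- n) = v2 * (v1 * INR i / v2 - IZR (Int_part (v1 * INR i / v2))
        - (v1 * INR j / v2 - IZR (Int_part (v1 * INR j / v2))))).
    { unfold m, n; rewrite opp_IZR, !minus_IZR, <- !INR_IZR_INZ; field; auto. }
    assert (Hs : Rabs (v1 * IZR m + v2 * IZR (- n)) < theta).
    { rewrite E, Rabs_mult. eapply Rle_lt_trans; [|exact HN'].
      apply Rmult_le_compat_l; [apply Rabs_pos|lra]. }
    assert (H0 : v1 * IZR m + v2 * IZR (- n) <> 0) by (apply Hnz; unfold m; lia).
    apply Rabs_def2 in Hs.
    destruct (Rlt_dec 0 (v1 * IZR m + v2 * IZR (- n))) as [Hp|Hp].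
    + exists m, (- n)%Z; unfold dot, lat; simpl; lra.
    + exists (- m)%Z, n; unfold dot, lat; simpl. rewrite opp_IZR in *; lra.
Qed.

Lemma lat_scale n i j p : dot p (lat (n * i) (n * j)) = IZR n * dot p (lat i j).
Proof. unfold dot, lat; simpl; rewrite !mult_IZR; ring. Qed.

(** The first multiple beyond [X] of a positive value smaller than [X] overshoots by less than
    [X]. *)
Lemma lattice_value_between (v : C) (X : R) : 0 < X ->
  (forall theta, 0 < theta -> exists i j, 0 < dot v (lat i j) < theta) ->
  exists i j, X <= dot v (lat i j) <= 2 * X.
Proof.
  intros HX H; destruct (H X HX) as (i & j & Hij).
  set (t := dot v (lat i j)) in *. destruct (archimed (X / t)) as [H1 H2].
  exists (up (X / t) * i)%Z, (up (X / t) * j)%Z; rewrite lat_scale; fold t.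
  set (n := IZR (up (X / t))) in *.
  assert (E : X = X / t * t) by (field; lra). nra.
Qed.

(** Cramer's rule for the basis [p], [v]. It turns closeness along and across the transversal into
    closeness in the plane. *)
Lemma dual_basis_bound (p v : C) : fst p * snd v - snd p * fst v <> 0 ->
  exists Lam, 0 < Lam /\ forall e, Cmod e <= Lam * (Rabs (dot p e) + Rabs (dot v e)).
Proof.
  intros Hd; set (D := fst p * snd v - snd p * fst v) in *.
  assert (HD : 0 < Rabs D) by now apply Rabs_pos_lt.
  set (T := Rabs (fst p) + Rabs (snd p) + Rabs (fst v) + Rabs (snd v)).
  assert (HT : 0 <= T /\ Rabs (fst p) <= T /\ Rabs (snd p) <= T /\ Rabs (fst v) <= T /\ Rabs (snd v) <= T).
  { unfold T; pose proof (Rabs_pos (fst p)); pose proof (Rabs_pos (snd p));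
    pose proof (Rabs_pos (fst v)); pose proof (Rabs_pos (snd v)); lra. }
  exists (2 * T / Rabs D + 1); split.
  { assert (0 <= 2 * T / Rabs D) by (apply Rle_mult_inv_pos; lra); lra. }
  intros e. set (P := Rabs (dot p e)); set (V := Rabs (dot v e)).
  assert (HP : 0 <= P) by apply Rabs_pos. assert (HV : 0 <= V) by apply Rabs_pos.
  assert (E1 : fst e = (dot p e * snd v - dot v e * snd p) / D).
  { apply Rmult_eq_reg_r with D; auto. field_simplify; auto. unfold dot, D; ring. }
  assert (E2 : snd e = (dot v e * fst p - dot p e * fst v) / D).
  { apply Rmult_eq_reg_r with D; auto. field_simplify; auto. unfold dot, D; ring. }
  assert (Hc : forall x y, Rabs x <= T -> Rabs y <= T ->
     Rabs ((dot p e * x - dot v e * y) / D) <= T * (P + V) / Rabs D).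
  { intros x y Hx Hy; unfold Rdiv; rewrite Rabs_mult, Rabs_inv.
    apply Rmult_le_compat_r; [left; now apply Rinv_0_lt_compat|].
    unfold Rminus; eapply Rle_trans; [apply Rabs_triang|].
    rewrite Rabs_Ropp, !Rabs_mult; fold P V.
    pose proof (Rmult_le_compat_l P _ _ HP Hx); pose proof (Rmult_le_compat_l V _ _ HV Hy); lra. }
  eapply Rle_trans; [apply Cmod_le_abs|].
  assert (H1 : Rabs (fst e) <= T * (P + V) / Rabs D) by (rewrite E1; apply Hc; apply HT).
  assert (H2 : Rabs (snd e) <= T * (P + V) / Rabs D).
  { rewrite E2. replace (dot v e * fst p - dot p e * fst v)
      with (- (dot p e * fst v - dot v e * fst p)) by ring.
    unfold Rdiv; rewrite Ropp_mult_distr_l_reverse, Rabs_Ropp; apply Hc; apply HT. }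
  replace ((2 * T / Rabs D + 1) * (P + V)) with (2 * (T * (P + V) / Rabs D) + (P + V)) by (field; lra).
  lra.
Qed.

(** Neither function can grow faster than the rate [M1], so a near-maximal gain of the mean leaves a
    total deficit of at most [2 * kappa] for [up], and no piece of the chain can miss more than
    that. *)
Lemma calibrated_summand b r x0 x1 L kappa M1 eta (up uq : C -> R) :
  (forall z z', Cmod (z' - z)%C <= r -> up z' - up z <= M1 * b z * Cmod (z' - z)%C) ->
  (forall z z', Cmod (z' - z)%C <= r -> uq z' - uq z <= M1 * b z * Cmod (z' - z)%C) ->
  (forall z, 0 < b z) -> 1 <= M1 -> (M1 - 1 + eta) * L <= kappa -> chain b r x0 x1 L ->
  (1 - eta) * L <= (up x1 + uq x1) / 2 - (up x0 + uq x0) / 2 ->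
  calibrated b r x0 x1 L kappa up.
Proof.
  intros Hp Hq Hpos HM Hk Hc Hw c d l1 l2 l3 H1 H2 H3 Hl.
  pose proof (chain_upper _ _ _ _ _ _ _ Hp H1); pose proof (chain_upper _ _ _ _ _ _ _ Hp H3).
  pose proof (chain_upper _ _ _ _ _ _ _ Hq Hc).
  pose proof (chain_ge0 _ _ _ _ _ Hpos H2).
  assert (1 * l2 <= M1 * l2) by (apply Rmult_le_compat_r; lra).
  replace L with (l1 + l2 + l3) in * by auto. lra.
Qed.

(** Up to [c] both functions gain between [l1 - 2 * kappa] and [l1 + kappa]. *)
Lemma calibrated_drift b r x0 x1 c l1 l2 L kappa M1 (up uq : C -> R) :
  (forall z z', Cmod (z' - z)%C <= r -> up z' - up z <= M1 * b z * Cmod (z' - z)%C) ->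
  (forall z z', Cmod (z' - z)%C <= r -> uq z' - uq z <= M1 * b z * Cmod (z' - z)%C) ->
  (forall z, 0 < b z) -> 1 <= M1 -> (M1 - 1) * L <= kappa ->
  calibrated b r x0 x1 L kappa up -> calibrated b r x0 x1 L kappa uq ->
  chain b r x0 c l1 -> chain b r c x1 l2 -> l1 + l2 = L ->
  Rabs ((uq c - up c) - (uq x0 - up x0)) <= 3 * kappa.
Proof.
  intros Hp Hq Hpos HM Hk Hcp Hcq H1 H2 Hl.
  pose proof (chain_upper _ _ _ _ _ _ _ Hp H1); pose proof (chain_upper _ _ _ _ _ _ _ Hq H1).
  pose proof (chain_ge0 _ _ _ _ _ Hpos H2).
  pose proof (Hcp x0 c 0 l1 l2 (chain_nil _ _ _) H1 H2 ltac:(lra)).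
  pose proof (Hcq x0 c 0 l1 l2 (chain_nil _ _ _) H1 H2 ltac:(lra)).
  assert ((M1 - 1) * l1 <= (M1 - 1) * L) by (apply Rmult_le_compat_l; lra).
  apply Rabs_le; lra.
Qed.

(** * Close translates of a calibrated chain *)

Lemma level_local b m u iota r : 0 <= m -> 0 <= r -> 0 <= iota ->
  (forall x y, Cmod (x - y)%C <= r -> b x <= (1 + iota) * b y) -> level b m u ->
  forall z z', Cmod (z' - z)%C <= r -> u z' - u z <= m * (1 + iota) * b z * Cmod (z' - z)%C.
Proof.
  intros Hm Hr Hi Hb Hu z z' Hz.
  replace (m * (1 + iota) * b z) with (m * ((1 + iota) * b z)) by ring.
  apply (level_ball b m u z r); auto. rewrite Cmod_self; auto.
Qed.

Lemma chain_cross_line b r x0 x1 L p T :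
  chain b r x0 x1 L -> dot p x0 < T <= dot p x1 ->
  exists c l1 l2, chain b r x0 c l1 /\ chain b r c x1 l2 /\ l1 + l2 = L /\
    T <= dot p c <= T + Cmod p * r.
Proof.
  intros Hc HT.
  destruct (chain_crossing b r (fun c => T <= dot p c) _ _ _ Hc)
    as (c & c' & l1 & l2 & H1 & H2 & H3 & H4 & H5 & H6); [lra|lra|].
  exists c', (l1 + b c * Cmod (c' - c)%C), l2; repeat split; auto.
  - now apply chain_step.
  - pose proof (dot_le p (c' - c)%C) as H; rewrite dot_minus_r in H.
    pose proof (Rmult_le_compat_l _ _ _ (Cmod_ge_0 p) H3). lra.
Qed.

Lemma nat_above (x : R) : exists N, (1 <= N)%nat /\ x <= INR N.
Proof.
  destruct (INR_unbounded x) as [n Hn]; exists (S n); split; [lia|]; rewrite S_INR; lra.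
Qed.

(** The constants are chosen in the order [K], [omega], [rho], [delta], then the lattice vector and
    its value [theta], then the number [N] of translates, the chain cost [M], and finally [kappa],
    [iota], [r]. The functions and the chain come only after these. The contradiction is [theta <= 6
    * q + 10 * kappa < 9 * q <= theta]. *)
Lemma no_flat_irrational b b0 B p1 p2 :
  let p := (RtoC (1 / 2) * (p1 + p2))%C in
  let v := (p2 - p1)%C in
  0 < b0 -> (forall z, b0 <= b z <= B) -> (forall z i j, b (z + lat i j)%C = b z) ->
  (forall omega, 0 < omega -> exists rho, 0 < rho /\
     forall x y, Cmod (x - y)%C <= rho -> b x <= (1 + omega) * b y) ->
  fst p * snd v - snd p * fst v <> 0 ->
  irrational_dir (fst v) (snd v) ->
  (forall m, 1 < m -> exists u, quasi p1 u /\ level b m u) ->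
  (forall m, 1 < m -> exists u, quasi p2 u /\ level b m u) ->
  ~ strict_sub b p -> False.
Proof.
  intros p v Hb0 Hb Hper Huc Hdet Hirr Hu1 Hu2 Hns.
  assert (Hpos : forall z, 0 < b z) by (intro z; destruct (Hb z); lra).
  assert (HB : 0 < B) by (destruct (Hb (RtoC 0)); lra).
  destruct (dual_basis_bound p v Hdet) as (Lam & HLam & Hdual).
  set (C0 := 8 * B + 2 * Cmod p1 + 2 * Cmod p2).
  assert (HC0 : 0 < C0) by (unfold C0; pose proof (Cmod_ge_0 p1); pose proof (Cmod_ge_0 p2); lra).
  (* The factor 60 makes [Lam * theta] at most [3 / 10 * delta] when [theta <= 18 * q]. *)
  set (K := Rmax 1 (60 * B * Lam)).
  assert (HK1 : 1 <= K) by apply Rmax_l.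
  assert (HK2 : 60 * B * Lam <= K) by apply Rmax_r.
  set (omega := / (96 * (K * K))).
  assert (Hom : 0 < omega) by (apply Rinv_0_lt_compat; nra).
  assert (HomK : 96 * omega * (K * K) <= 1) by (unfold omega; right; field; lra).
  destruct (Huc omega Hom) as (rho1 & Hrho1 & Hvar1).
  set (rho := rho1 / 2).
  set (delta := rho / (K + 1)).
  assert (Hdelta : 0 < delta) by (apply Rdiv_lt_0_compat; unfold rho; lra).
  assert (Hdr : (K + 1) * delta <= rho) by (unfold delta; right; field; lra).
  set (q := B * delta / K).
  assert (Hq : 0 < q) by (apply Rdiv_lt_0_compat; nra).
  (* Flatness costs [6 * q + 4 * kappa] and the drift at two points [6 * kappa]; with
     [kappa <= q / 4] the sum stays below [9 * q]. *)
  destruct (lattice_value_between v (9 * q) ltac:(lra) (small_lattice_value v Hirr))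
    as (i0 & j0 & Hth).
  set (theta := dot v (lat i0 j0)) in *.
  assert (HLth : Lam * theta <= 3 / 10 * delta).
  { apply Rle_trans with (Lam * (18 * q)); [apply Rmult_le_compat_l; lra|].
    apply Rmult_le_reg_r with K; [lra|].
    replace (Lam * (18 * q) * K) with (18 * (B * Lam) * delta) by (unfold q; field; lra).
    replace (3 / 10 * delta * K) with (3 / 10 * K * delta) by ring.
    apply Rmult_le_compat_r; lra. }
  (* The positions of the translates along the transversal fill an interval of length
     [2 * C0 + 3 + N * theta = N * h]; a large [N] brings the cell length [h] close to [theta]. *)
  destruct (nat_above (6 * Lam * (2 * C0 + 3) / delta)) as (N & HN1 & HN2).
  assert (HNpos : 1 <= INR N) by (apply (le_INR 1 N); auto).
  set (h := (2 * C0 + 3) / INR N + theta).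
  assert (Hh : 0 < h).
  { assert (0 < (2 * C0 + 3) / INR N) by (apply Rdiv_lt_0_compat; lra). unfold h; lra. }
  assert (HLh : Lam * h <= delta / 6 + 3 / 10 * delta).
  { unfold h; rewrite Rmult_plus_distr_l; apply Rplus_le_compat; [|exact HLth].
    apply Rmult_le_reg_r with (6 * INR N / delta); [apply Rdiv_lt_0_compat; lra|].
    replace (Lam * ((2 * C0 + 3) / INR N) * (6 * INR N / delta))
      with (6 * Lam * (2 * C0 + 3) / delta) by (field; lra).
    replace (delta / 6 * (6 * INR N / delta)) with (INR N) by (field; lra). exact HN2. }
  set (Q := Cmod p). assert (HQ : 0 <= Q) by apply Cmod_ge_0.
  set (J := INR N * Rabs (dot p (lat i0 j0))).
  assert (HJ : 0 <= J) by (apply Rmult_le_pos; [lra|apply Rabs_pos]).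
  set (s := K * delta). assert (Hs : 0 < s) by (unfold s; nra).
  assert (HQs : 0 <= Q * s) by nra.
  (* Required extent of the chain in [dot p]: room for all the lines [T - j * pk], which vary by at
     most [J] either way, plus a margin keeping their crossings at distance [s] from both ends. *)
  set (Y := 2 * J + 2 * (Q * s) + Q + 2).
  set (M := 2 * (Y + C0)).
  assert (HM : 0 < M) by (unfold M, Y; lra).
  set (kappa := Rmin (Rmin (omega * s * b0) (q / 4)) (1 / 3)).
  assert (Hk : 0 < kappa /\ kappa <= omega * s * b0 /\ kappa <= q / 4 /\ kappa <= 1 / 3).
  { assert (0 < omega * s * b0) by (apply Rmult_lt_0_compat; [apply Rmult_lt_0_compat|]; auto).
    repeat split; unfold kappa, Rmin; repeat (destruct Rle_dec); lra. }
  destruct Hk as (Hk0 & Hk1 & Hk2 & Hk3).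
  (* The relative deficit is at most [4 * iota], and the chain costs at most [M + 1], so the total
     deficit is at most [kappa]. *)
  set (iota := Rmin (Rmin (kappa / (4 * (M + 1))) omega) (1 / 2)).
  assert (Hi : 0 < iota /\ iota <= kappa / (4 * (M + 1)) /\ iota <= omega /\ iota <= 1 / 2).
  { assert (0 < kappa / (4 * (M + 1))) by (apply Rdiv_lt_0_compat; lra).
    repeat split; unfold iota, Rmin; repeat (destruct Rle_dec); lra. }
  destruct Hi as (Hi0 & Hi1 & Hi2 & Hi3).
  assert (HiM : 4 * iota * (M + 1) <= kappa).
  { replace kappa with (kappa / (4 * (M + 1)) * (4 * (M + 1))) by (field; lra).
    replace (4 * iota * (M + 1)) with (iota * (4 * (M + 1))) by ring.
    apply Rmult_le_compat_r; lra. }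
  destruct (Huc iota Hi0) as (r2 & Hr2 & Hvar2).
  (* Crossing a line overshoots by at most [Q * r]; this must cost at most [delta / 3] in the bound
     on [z - c j]. *)
  set (r3 := delta / (3 * Lam * (Q + 1))).
  assert (Hr3 : 0 < r3) by (apply Rdiv_lt_0_compat; [lra|repeat apply Rmult_lt_0_compat; lra]).
  set (r := Rmin (Rmin (Rmin r2 delta) (Rmin (/ B) 1)) r3).
  assert (Hr : 0 < r /\ r <= r2 /\ r <= delta /\ r <= / B /\ r <= 1 /\ r <= r3).
  { pose proof (Rinv_0_lt_compat B HB). repeat split; unfold r, Rmin; repeat (destruct Rle_dec); lra. }
  destruct Hr as (Hr & Hrr2 & Hrd & HrB & Hr1 & Hrr3).
  assert (HrB' : r * B <= 1).
  { replace 1 with (/ B * B) by (field; lra). apply Rmult_le_compat_r; lra. }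
  assert (HLQr : Lam * (Q * r) <= delta / 3).
  { apply Rle_trans with (Lam * ((Q + 1) * r3)).
    - apply Rmult_le_compat_l; [lra|]. apply Rmult_le_compat; lra.
    - unfold r3; right; field; lra. }
  destruct (Hu1 (1 + iota) ltac:(lra)) as (u1 & Hq1 & Hl1).
  destruct (Hu2 (1 + iota) ltac:(lra)) as (u2 & Hq2 & Hl2).
  set (M1 := (1 + iota) * (1 + iota)).
  assert (HM1 : 1 <= M1 /\ M1 - 1 + iota <= 4 * iota).
  { assert (0 <= iota * iota <= iota * 1) by (split; [apply Rmult_le_pos|apply Rmult_le_compat_l]; lra).
    unfold M1; lra. }
  assert (Hloc : forall u, level b (1 + iota) u ->
    forall z z', Cmod (z' - z)%C <= r -> u z' - u z <= M1 * b z * Cmod (z' - z)%C).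
  { intros u Hu; apply level_local; auto; try lra. intros x y Hxy; apply Hvar2; lra. }
  pose proof (Hloc u1 Hl1) as Hs1; pose proof (Hloc u2 Hl2) as Hs2.
  assert (Hdp : forall z, dot p z = (dot p1 z + dot p2 z) / 2)
    by (intro z; unfold p, dot; simpl; field).
  assert (Hdv : forall z, dot v z = dot p2 z - dot p1 z)
    by (intro z; unfold v, dot; simpl; ring).
  set (w := fun z => (u1 z + u2 z) / 2).
  destruct (calibrated_chain b B p w M1 r M iota) as (x0 & x1 & L & Hch & HL & Hcal); auto; try lra.
  { intro z; destruct (Hb z); split; auto. }
  { intros z i j; unfold w; rewrite Hq1, Hq2, Hdp; field. }
  { intros z z' Hz; specialize (Hs1 z z' Hz); specialize (Hs2 z z' Hz); unfold w; lra. }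
  assert (HkL : (M1 - 1 + iota) * L <= kappa).
  { apply Rle_trans with (4 * iota * (M + 1)); [|exact HiM]. apply Rmult_le_compat; lra. }
  assert (HkL' : (M1 - 1) * L <= kappa).
  { assert (0 <= iota * L) by (apply Rmult_le_pos; lra). lra. }
  assert (Hc1 : calibrated b r x0 x1 L kappa u1)
    by (apply (calibrated_summand b r x0 x1 L kappa M1 iota u1 u2); auto; apply HM1).
  assert (Hc2 : calibrated b r x0 x1 L kappa u2).
  { apply (calibrated_summand b r x0 x1 L kappa M1 iota u2 u1); auto; [apply HM1|].
    unfold w in Hcal; lra. }
  assert (Ho1 := level_osc b B p1 _ u1 HB (fun z => proj2 (Hb z)) Hq1 Hl1 ltac:(lra)).
  assert (Ho2 := level_osc b B p2 _ u2 HB (fun z => proj2 (Hb z)) Hq2 Hl2 ltac:(lra)).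
  assert (Hfar : Y <= dot p x1 - dot p x0).
  { specialize (Ho1 x0 x1); specialize (Ho2 x0 x1); apply Rabs_le_between in Ho1, Ho2.
    rewrite dot_minus_r in Ho1, Ho2. rewrite !Hdp.
    assert (1 / 2 * M <= (1 - iota) * L) by (apply Rmult_le_compat; lra).
    unfold w in Hcal. assert (M / 2 = Y + C0) by (unfold M; field). unfold C0 in *.
    pose proof (Cmod_ge_0 p1); pose proof (Cmod_ge_0 p2); lra. }
  set (T := dot p x0 + J + Q * s + 1).
  set (pk := dot p (lat i0 j0)) in *.
  assert (HJj : forall j, (j <= N)%nat -> - J <= INR j * pk <= J).
  { intros j Hj; apply Rabs_le_between; rewrite Rabs_mult, (Rabs_pos_eq (INR j)) by apply pos_INR.
    apply Rmult_le_compat_r; [apply Rabs_pos|now apply le_INR]. }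
  (* The chain stays fixed and the line is moved back instead: [c j] translated by [j] times the
     lattice vector lies near the common line [dot p = T]. The dummy value [x0] for [j > N] makes
     the choice total. *)
  assert (Hcross : forall j, exists c, (j <= N)%nat -> exists l1 l2,
     chain b r x0 c l1 /\ chain b r c x1 l2 /\ l1 + l2 = L /\
     T - INR j * pk <= dot p c <= T - INR j * pk + Q * r).
  { intro j; destruct (le_dec j N) as [Hj|Hj]; [|exists x0; tauto].
    specialize (HJj j Hj).
    destruct (chain_cross_line b r x0 x1 L p (T - INR j * pk) Hch) as (c & l1 & l2 & H).
    - unfold T, Y in *; lra.
    - exists c; intros _; exists l1, l2; exact H. }
  set (c := fun j => proj1_sig (constructive_indefinite_description _ (Hcross j))).
  assert (Hc : forall j, (j <= N)%nat -> exists l1 l2,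
     chain b r x0 (c j) l1 /\ chain b r (c j) x1 l2 /\ l1 + l2 = L /\
     T - INR j * pk <= dot p (c j) <= T - INR j * pk + Q * r).
  { intro j; exact (proj2_sig (constructive_indefinite_description _ (Hcross j))). }
  clearbody c; clear Hcross.
  assert (Hdrift : forall j, (j <= N)%nat ->
     Rabs ((u2 (c j) - u1 (c j)) - (u2 x0 - u1 x0)) <= 3 * kappa).
  { intros j Hj; destruct (Hc j Hj) as (l1 & l2 & H1 & H2 & H3 & _).
    apply (calibrated_drift b r x0 x1 (c j) l1 l2 L kappa M1 u1 u2); auto; apply HM1. }
  (* Since [f] is almost constant on the chain and differs from [dot v] by a bounded periodic term,
     [dot v (c j)] stays within [C0 + 1] of [dot v x0]. *)
  destruct (pigeonhole_real N (fun j => dot v (c j) + INR j * theta) (dot v x0 - C0 - 1) h Hh)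
    as (j & i & Hji & Hclose).
  { intros j Hj; specialize (Hdrift j Hj); apply Rabs_le_between in Hdrift.
    specialize (Ho1 x0 (c j)); specialize (Ho2 x0 (c j)); apply Rabs_le_between in Ho1, Ho2.
    rewrite dot_minus_r in Ho1, Ho2.
    assert (0 <= INR j * theta <= INR N * theta).
    { pose proof (pos_INR j); pose proof (le_INR _ _ Hj).
      split; [apply Rmult_le_pos; lra|apply Rmult_le_compat_r; lra]. }
    replace (INR N * h) with (2 * C0 + 3 + INR N * theta) by (unfold h; field; lra).
    rewrite !Hdv. unfold C0. pose proof (Cmod_ge_0 p1); pose proof (Cmod_ge_0 p2); lra. }
  destruct (Hc j ltac:(lia)) as (l1 & l2 & Hj1 & Hj2 & HjL & Hjp).
  destruct (Hc i ltac:(lia)) as (_ & _ & _ & _ & _ & Hip).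
  pose proof (Hdrift j ltac:(lia)) as Dj; pose proof (Hdrift i ltac:(lia)) as Di.
  set (n := (Z.of_nat i - Z.of_nat j)%Z).
  assert (Hn : IZR n = INR i - INR j) by (unfold n; rewrite minus_IZR, <- !INR_IZR_INZ; ring).
  (* As [j < i], this moves [c i] by a positive multiple of the lattice vector to a point near
     [c j], raising [f] by at least [theta]. *)
  set (z := (c i + lat (n * i0) (n * j0))%C).
  assert (Hz : Cmod (z - c j)%C <= delta).
  { eapply Rle_trans; [apply Hdual|].
    assert (E1 : Rabs (dot p (z - c j)%C) <= Q * r).
    { unfold z; rewrite dot_minus_r, dot_plus_r, lat_scale, Hn; fold pk. apply Rabs_le; lra. }
    assert (E2 : Rabs (dot v (z - c j)%C) <= h).
    { unfold z; rewrite dot_minus_r, dot_plus_r, lat_scale, Hn; fold theta.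
      apply Rabs_def2 in Hclose. apply Rabs_le; lra. }
    apply Rle_trans with (Lam * (Q * r + h)); [apply Rmult_le_compat_l; lra|]. lra. }
  assert (Hfar0 : s <= Cmod (x0 - c j)%C).
  { apply Rnot_lt_le; intro Hlt. pose proof (dot_le p (c j - x0)%C) as H.
    rewrite dot_minus_r, Cmod_minus_sym in H. fold Q in H.
    assert (Q * Cmod (x0 - c j)%C <= Q * s) by (apply Rmult_le_compat_l; lra).
    pose proof (HJj j ltac:(lia)). unfold T in *; lra. }
  assert (Hfar1 : s <= Cmod (x1 - c j)%C).
  { apply Rnot_lt_le; intro Hlt. pose proof (dot_le p (x1 - c j)%C) as H.
    rewrite dot_minus_r in H. fold Q in H.
    assert (Q * Cmod (x1 - c j)%C <= Q * s) by (apply Rmult_le_compat_l; lra).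
    assert (Q * r <= Q * 1) by (apply Rmult_le_compat_l; lra).
    pose proof (HJj j ltac:(lia)). unfold T, Y in *; lra. }
  assert (Hflat : (u2 z - u1 z) - (u2 (c j) - u1 (c j)) <= 6 * b (c j) * delta / K + 4 * kappa).
  { apply (calibrated_flat b r x0 x1 l1 l2 kappa (1 + iota) u1 u2 (c j) z K delta rho omega); auto;
      try (rewrite HjL; assumption); try lra.
    - intros x Hx; split; apply Hvar1; [|rewrite Cmod_minus_sym]; unfold rho in *; lra.
    - fold s. eapply Rle_trans; [exact Hk1|]. apply Rmult_le_compat_l; [apply Rmult_le_pos; lra|apply Hb]. }
  assert (Hb6 : 6 * b (c j) * delta / K <= 6 * q).
  { replace (6 * b (c j) * delta / K) with (6 * (delta / K) * b (c j)) by (field; lra).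
    replace (6 * q) with (6 * (delta / K) * B) by (unfold q; field; lra).
    apply Rmult_le_compat_l; [|apply Hb].
    assert (0 < delta / K) by (apply Rdiv_lt_0_compat; lra). lra. }
  assert (Hgain : theta <= IZR n * theta).
  { rewrite Hn. assert (1 <= INR i - INR j).
    { pose proof (le_INR (S j) i ltac:(lia)); rewrite S_INR in *; lra. }
    rewrite <- (Rmult_1_l theta) at 1. apply Rmult_le_compat_r; lra. }
  assert (Ez : u2 z - u1 z = u2 (c i) - u1 (c i) + IZR n * theta).
  { unfold z; rewrite Hq1, Hq2, !lat_scale. unfold theta; rewrite Hdv; ring. }
  apply Rabs_le_between in Dj, Di. lra.
Qed.

(** * Steklov averages *)

Definition loc_lip (g : R -> R -> R) (c r : R) : Prop :=
  forall x y u v, Rabs (u - x) <= r -> Rabs (v - y) <= r ->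
    Rabs (g u v - g x y) <= c * (Rabs (u - x) + Rabs (v - y)).

Lemma loc_lip_continuity_2d g c r x y : 0 < r -> 0 <= c -> loc_lip g c r -> continuity_2d_pt g x y.
Proof.
  intros Hr Hc Hg eps.
  assert (Hd : 0 < Rmin r (eps / (2 * (c + 1)))).
  { apply Rmin_pos; auto. apply Rdiv_lt_0_compat; [apply cond_pos|lra]. }
  exists (mkposreal _ Hd); simpl; intros u v Hu Hv.
  pose proof (Rmin_l r (eps / (2 * (c + 1)))); pose proof (Rmin_r r (eps / (2 * (c + 1)))).
  eapply Rle_lt_trans; [apply Hg; lra|].
  set (e := eps / (2 * (c + 1))) in *.
  assert (E : pos eps = 2 * (c + 1) * e) by (unfold e; field; lra). rewrite E.
  assert (0 < e) by (apply Rdiv_lt_0_compat; [apply cond_pos|lra]).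
  apply Rle_lt_trans with (c * (e + e)); [apply Rmult_le_compat_l; lra|lra].
Qed.

Lemma loc_lip_swap g c r : loc_lip g c r -> loc_lip (fun x y => g y x) c r.
Proof. intros H x y u v Hu Hv; rewrite (Rplus_comm (Rabs (u - x))); now apply H. Qed.

Lemma loc_lip_continuous g c r y x : 0 < r -> 0 <= c -> loc_lip g c r ->
  continuous (fun s => g s y) x.
Proof.
  intros Hr Hc Hg. apply continuity_pt_filterlim.
  intros eps Heps.
  destruct (loc_lip_continuity_2d g c r x y Hr Hc Hg (mkposreal eps Heps)) as [d Hd].
  exists d; split; [apply cond_pos|]. intros u [_ Hu].
  apply Hd; [exact Hu|rewrite Rminus_diag, Rabs_R0; apply cond_pos].
Qed.

Definition avg (g : R -> R -> R) (h x y : R) : R := RInt (fun s => g (x + s) y) 0 h.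

Lemma loc_lip_shift g c r d e : loc_lip g c r -> loc_lip (fun x y => g (x + d) (y + e)) c r.
Proof.
  intros H x y u v Hu Hv. specialize (H (x + d) (y + e) (u + d) (v + e)).
  replace (u + d - (x + d)) with (u - x) in H by ring.
  replace (v + e - (y + e)) with (v - y) in H by ring. auto.
Qed.

Lemma avg_ex g c r h x y : 0 < r -> 0 <= c -> loc_lip g c r ->
  ex_RInt (fun s => g (x + s) y) 0 h.
Proof.
  intros Hr Hc Hg; apply (ex_RInt_continuous (V := R_CompleteNormedModule)); intros s _.
  apply continuous_ext with (fun s => g (s + x) (y + 0)).
  - intro t; now rewrite Rplus_comm, Rplus_0_r.
  - apply (loc_lip_continuous (fun a b => g (a + x) (b + 0)) c r); auto. now apply loc_lip_shift.
Qed.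

Lemma avg_le g c r h x y x' y' k : 0 < r -> 0 <= c -> loc_lip g c r -> 0 <= h ->
  (forall s, 0 <= s <= h -> g (x' + s) y' <= g (x + s) y + k) ->
  avg g h x' y' <= avg g h x y + h * k.
Proof.
  intros Hr Hc Hg Hh H. unfold avg.
  pose proof (avg_ex g c r h x y Hr Hc Hg) as E1; pose proof (avg_ex g c r h x' y' Hr Hc Hg) as E2.
  assert (E3 : ex_RInt (fun _ : R => k) 0 h) by apply ex_RInt_const.
  replace (h * k) with (RInt (fun _ : R => k) 0 h)
    by (rewrite RInt_const; unfold scal; simpl; unfold mult; simpl; ring).
  eapply Rle_trans; [|right; exact (RInt_plus (V := R_CompleteNormedModule) _ _ _ _ E1 E3)].
  apply RInt_le; auto.
  - apply (ex_RInt_plus (V := R_NormedModule)); auto.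
  - intros s Hs; apply H; lra.
Qed.

Lemma avg_loc_lip g c r h : 0 < r -> 0 <= c -> 0 <= h -> loc_lip g c r -> loc_lip (avg g h) (h * c) r.
Proof.
  intros Hr Hc Hh Hg x y u v Hu Hv.
  set (k := c * (Rabs (u - x) + Rabs (v - y))).
  assert (Hk : forall s, Rabs (g (u + s) v - g (x + s) y) <= k).
  { intro s. unfold k. replace (u - x) with ((u + s) - (x + s)) by ring. apply Hg; auto.
    now replace (u + s - (x + s)) with (u - x) by ring. }
  assert (H1 : avg g h u v <= avg g h x y + h * k).
  { apply (avg_le g c r); auto. intros s _; specialize (Hk s); apply Rabs_le_between in Hk; lra. }
  assert (H2 : avg g h x y <= avg g h u v + h * k).
  { apply (avg_le g c r); auto. intros s _; specialize (Hk s); apply Rabs_le_between in Hk; lra. }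
  rewrite Rmult_assoc; fold k. apply Rabs_le; lra.
Qed.

Lemma avg_derive g c r h x y : 0 < r -> 0 <= c -> loc_lip g c r ->
  is_derive (fun x => avg g h x y) x (g (x + h) y - g x y).
Proof.
  intros Hr Hc Hg.
  assert (Hcont : forall s, continuous (fun s => g s y) s)
    by (intro; apply (loc_lip_continuous g c r); auto).
  assert (Hex : forall a b, ex_RInt (fun s => g s y) a b)
    by (intros; apply (ex_RInt_continuous (V := R_CompleteNormedModule)); auto).
  set (F := fun x => RInt (fun s => g s y) 0 x).
  assert (HF : forall x, is_derive F x (g x y)).
  { intro t. apply (is_derive_RInt (fun s => g s y) F 0 t); [|apply Hcont].
    apply filter_forall; intro b; apply (RInt_correct (V := R_CompleteNormedModule)); auto. }
  apply is_derive_ext with (fun x => F (x + h) - F x).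
  - intro t; unfold F, avg.
    assert (E : RInt (fun s => g (t + s) y) 0 h = RInt (fun s => g s y) t (t + h)).
    { transitivity (RInt (fun s => scal 1 (g (1 * s + t) y)) 0 h).
      - apply RInt_ext; intros s _; unfold scal; simpl; unfold mult; simpl.
        rewrite !Rmult_1_l; f_equal; ring.
      - rewrite (RInt_comp_lin (V := R_CompleteNormedModule) (fun s => g s y)).
        + f_equal; ring.
        + apply Hex. }
    rewrite E.
    rewrite <- (RInt_Chasles (V := R_CompleteNormedModule) (fun s => g s y) 0 t (t + h)) by apply Hex.
    unfold plus; simpl; ring.
  - apply (is_derive_minus (V := R_NormedModule)); [|apply HF].
    replace (g (x + h) y) with (scal 1 (g (x + h) y)) by (unfold scal; simpl; unfold mult; simpl; ring).
    apply (is_derive_comp F (fun x => x + h)); [apply HF|].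
    auto_derive; auto.
Qed.

(** The integral of [g] over the square of side [h] with lower left corner [(x, y)], not divided by
    its area; it makes a locally Lipschitz function continuously differentiable. *)
Definition steklov (g : R -> R -> R) (h x y : R) : R := avg (fun t s => avg g h s t) h y x.

Definition steklov_dx (g : R -> R -> R) (h x y : R) : R :=
  avg (fun t s => g s t) h y (x + h) - avg (fun t s => g s t) h y x.

Definition steklov_dy (g : R -> R -> R) (h x y : R) : R := avg g h x (y + h) - avg g h x y.

Lemma steklov_derive_y g c r h x y : 0 < r -> 0 <= c -> 0 <= h -> loc_lip g c r ->
  is_derive (fun y => steklov g h x y) y (steklov_dy g h x y).
Proof.
  intros; unfold steklov, steklov_dy.
  apply (avg_derive (fun t s => avg g h s t) (h * c) r); auto; [nra|].
  apply loc_lip_swap, avg_loc_lip; auto.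
Qed.

(** Here [x] sits in the inner average, so the derivative is taken under the outer integral sign. *)
Lemma steklov_derive_x g c r h x y : 0 < r -> 0 <= c -> 0 <= h -> loc_lip g c r ->
  is_derive (fun x => steklov g h x y) x (steklov_dx g h x y).
Proof.
  intros Hr Hc Hh Hg; unfold steklov, steklov_dx, avg at 1.
  assert (HD : forall u t, Derive (fun z => avg g h z t) u = g (u + h) t - g u t).
  { intros u t; apply is_derive_unique, (avg_derive g c r); auto. }
  assert (Hs := loc_lip_swap _ _ _ Hg).
  replace (avg (fun t s => g s t) h y (x + h) - avg (fun t s => g s t) h y x)
    with (RInt (fun t => Derive (fun u => avg g h u (y + t)) x) 0 h).
  - apply (is_derive_RInt_param (fun z t => avg g h z (y + t)) 0 h x).
    + apply filter_forall; intros z t _; eexists; apply (avg_derive g c r); auto.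
    + intros t _. eapply continuity_2d_pt_ext.
      * intros u v; symmetry; apply HD.
      * apply continuity_2d_pt_minus.
        -- apply (loc_lip_continuity_2d (fun u v => g (u + h) (y + v)) c r); auto.
           intros a b u v Hu Hv. pose proof (loc_lip_shift _ _ _ h y Hg a b u v Hu Hv) as H.
           simpl in H; now rewrite (Rplus_comm y v), (Rplus_comm y b).
        -- apply (loc_lip_continuity_2d (fun u v => g u (y + v)) c r); auto.
           intros a b u v Hu Hv. pose proof (loc_lip_shift _ _ _ 0 y Hg a b u v Hu Hv) as H.
           simpl in H; rewrite !Rplus_0_r in H; now rewrite (Rplus_comm y v), (Rplus_comm y b).
    + apply filter_forall; intros z.
      apply (avg_ex (fun t s => avg g h s t) (h * c) r); auto; [nra|].
      apply loc_lip_swap, avg_loc_lip; auto.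
  - pose proof (avg_ex (fun t s => g s t) c r h y (x + h) Hr Hc Hs) as E1.
    pose proof (avg_ex (fun t s => g s t) c r h y x Hr Hc Hs) as E2.
    transitivity (RInt (fun t => minus (g (x + h) (y + t)) (g x (y + t))) 0 h).
    + apply RInt_ext; intros t _; apply HD.
    + exact (RInt_minus (V := R_CompleteNormedModule) _ _ _ _ E1 E2).
Qed.

Lemma loc_lip_minus f g c c' r : loc_lip f c r -> loc_lip g c' r ->
  loc_lip (fun x y => f x y - g x y) (c + c') r.
Proof.
  intros Hf Hg x y u v Hu Hv. specialize (Hf x y u v Hu Hv); specialize (Hg x y u v Hu Hv).
  apply Rabs_le_between in Hf, Hg. apply Rabs_le; lra.
Qed.

Lemma steklov_dx_continuity g c r h x y : 0 < r -> 0 <= c -> 0 <= h -> loc_lip g c r ->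
  continuity_2d_pt (steklov_dx g h) x y.
Proof.
  intros Hr Hc Hh Hg.
  assert (H : loc_lip (fun x y => avg (fun t s => g s t) h y x) (h * c) r).
  { apply (loc_lip_swap (avg (fun t s => g s t) h)), avg_loc_lip; auto. now apply loc_lip_swap. }
  apply (loc_lip_continuity_2d _ (h * c + h * c) r); auto; [nra|].
  apply (loc_lip_minus (fun x y => avg (fun t s => g s t) h y (x + h))
           (fun x y => avg (fun t s => g s t) h y x)); auto.
  intros a b u v Hu Hv. pose proof (loc_lip_shift _ _ _ h 0 H a b u v Hu Hv) as H'.
  simpl in H'; now rewrite !Rplus_0_r in H'.
Qed.

Lemma steklov_dy_continuity g c r h x y : 0 < r -> 0 <= c -> 0 <= h -> loc_lip g c r ->
  continuity_2d_pt (steklov_dy g h) x y.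
Proof.
  intros Hr Hc Hh Hg.
  assert (H := avg_loc_lip g c r h Hr Hc Hh Hg).
  apply (loc_lip_continuity_2d _ (h * c + h * c) r); auto; [nra|].
  apply (loc_lip_minus (fun x y => avg g h x (y + h)) (avg g h)); auto.
  intros a b u v Hu Hv. pose proof (loc_lip_shift _ _ _ 0 h H a b u v Hu Hv) as H'.
  simpl in H'; now rewrite !Rplus_0_r in H'.
Qed.

Lemma steklov_differentiable g c r h x y : 0 < r -> 0 <= c -> 0 <= h -> loc_lip g c r ->
  differentiable_pt_lim (steklov g h) x y (steklov_dx g h x y) (steklov_dy g h x y).
Proof.
  intros Hr Hc Hh Hg. apply filterdiff_differentiable_pt_lim.
  apply (is_derive_filterdiff (steklov g h) x y (steklov_dx g h) (steklov_dy g h x y)).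
  - apply filter_forall; intros [u v]; simpl; apply (steklov_derive_x g c r); auto.
  - apply (steklov_derive_y g c r); auto.
  - apply continuity_2d_pt_filterlim, (steklov_dx_continuity g c r); auto.
Qed.

Lemma steklov_periodic g h : periodic2 g -> periodic2 (steklov g h).
Proof.
  intros Hg x y; unfold steklov, avg; split; apply RInt_ext; intros t _; apply RInt_ext; intros s _.
  - replace (x + 1 + s) with (x + s + 1) by ring. apply Hg.
  - replace (y + 1 + t) with (y + t + 1) by ring. apply Hg.
Qed.

Lemma steklov_increment g c r h x y x' y' k : 0 < r -> 0 <= c -> 0 <= h -> loc_lip g c r ->
  (forall s t, 0 <= s <= h -> 0 <= t <= h -> g (x' + s) (y' + t) <= g (x + s) (y + t) + k) ->
  steklov g h x' y' <= steklov g h x y + h * (h * k).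
Proof.
  intros Hr Hc Hh Hg H; unfold steklov.
  apply (avg_le (fun t s => avg g h s t) (h * c) r); auto; [nra| |].
  - apply loc_lip_swap, avg_loc_lip; auto.
  - intros t Ht; apply (avg_le g c r); auto.
Qed.

(** * Passage to the effective Hamiltonian *)

Lemma periodic2_shift f : periodic2 f ->
  forall i j x y, f (x + IZR i) (y + IZR j) = f x y.
Proof.
  intros Hf.
  assert (Hn1 : forall n x y, f (x + INR n) y = f x y).
  { intro n; induction n as [|n IH]; intros x y; [simpl; now rewrite Rplus_0_r|].
    rewrite S_INR, <- Rplus_assoc, (proj1 (Hf _ _)); apply IH. }
  assert (Hn2 : forall n x y, f x (y + INR n) = f x y).
  { intro n; induction n as [|n IH]; intros x y; [simpl; now rewrite Rplus_0_r|].
    rewrite S_INR, <- Rplus_assoc, (proj2 (Hf _ _)); apply IH. }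
  assert (Hz1 : forall i x y, f (x + IZR i) y = f x y).
  { intros i x y; destruct (Z_le_dec 0 i) as [Hi|Hi].
    - rewrite <- (Z2Nat.id i), <- INR_IZR_INZ by lia; apply Hn1.
    - rewrite <- (Hn1 (Z.to_nat (- i)) (x + IZR i)). f_equal.
      rewrite INR_IZR_INZ, Z2Nat.id, opp_IZR by lia; ring. }
  intros i j x y; rewrite Hz1; destruct (Z_le_dec 0 j) as [Hj|Hj].
  - rewrite <- (Z2Nat.id j), <- INR_IZR_INZ by lia; apply Hn2.
  - rewrite <- (Hn2 (Z.to_nat (- j)) x (y + IZR j)). f_equal.
    rewrite INR_IZR_INZ, Z2Nat.id, opp_IZR by lia; ring.
Qed.

Lemma floor_shift x : exists i, 0 <= x + IZR i <= 1.
Proof. exists (- Int_part x)%Z; rewrite opp_IZR; destruct (base_Int_part x); lra. Qed.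

Lemma periodic2_uniformly_continuous f :
  (forall x y, continuity_2d_pt f x y) -> periodic2 f ->
  forall eps, 0 < eps -> exists rho, 0 < rho /\
    forall x y u v, Rabs (u - x) < rho -> Rabs (v - y) < rho -> Rabs (f u v - f x y) < eps.
Proof.
  intros Hc Hp eps Heps.
  (* A lattice translation brings one point into the unit square, and [rho <= 1] keeps the other in
     this larger square. *)
  destruct (uniform_continuity_2d f (-1) 2 (-1) 2 (fun x y _ _ => Hc x y) (mkposreal eps Heps))
    as [d Hd]; simpl in Hd.
  exists (Rmin d 1); split; [apply Rmin_pos; [apply cond_pos|lra]|].
  intros x y u v Hu Hv.
  pose proof (Rmin_l d 1); pose proof (Rmin_r d 1).
  destruct (floor_shift x) as [i Hi], (floor_shift y) as [j Hj].
  rewrite <- (periodic2_shift f Hp i j u v), <- (periodic2_shift f Hp i j x y).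
  pose proof (Rabs_def2 _ _ Hu); pose proof (Rabs_def2 _ _ Hv).
  apply Hd; try lra.
  - replace (u + IZR i - (x + IZR i)) with (u - x) by ring; lra.
  - replace (v + IZR j - (y + IZR j)) with (v - y) by ring; lra.
Qed.

(** A point of the unit square is reached from the origin in [n] equal steps, each changing [f] by
    less than 1. *)
Lemma periodic2_bounded f :
  (forall x y, continuity_2d_pt f x y) -> periodic2 f -> exists M, forall x y, Rabs (f x y) <= M.
Proof.
  intros Hc Hp.
  destruct (periodic2_uniformly_continuous f Hc Hp 1 Rlt_0_1) as (rho & Hrho & Hu).
  destruct (nat_above (2 / rho)) as (n & Hn1 & Hn2).
  assert (Hn : 1 <= INR n) by (apply (le_INR 1 n); auto).
  assert (Hnr : / INR n < rho).
  { apply Rmult_lt_reg_r with (INR n); [lra|]. rewrite Rinv_l by lra.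
    assert (2 / rho * rho <= INR n * rho) by (apply Rmult_le_compat_r; lra).
    replace (2 / rho * rho) with 2 in * by (field; lra). lra. }
  exists (Rabs (f 0 0) + INR n); intros x y.
  destruct (floor_shift x) as [i Hi], (floor_shift y) as [j Hj].
  rewrite <- (periodic2_shift f Hp i j x y).
  set (x' := x + IZR i) in *; set (y' := y + IZR j) in *; clearbody x' y'.
  assert (Hk : forall k, Rabs (f (INR k * (x' / INR n)) (INR k * (y' / INR n))) <= Rabs (f 0 0) + INR k).
  { assert (Hs : forall t, 0 <= t <= 1 -> Rabs (t / INR n) < rho).
    { intros t Ht; rewrite Rabs_pos_eq by (apply Rle_mult_inv_pos; lra).
      eapply Rle_lt_trans; [|exact Hnr]. unfold Rdiv. rewrite <- (Rmult_1_l (/ INR n)) at 2.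
      apply Rmult_le_compat_r; [left; apply Rinv_0_lt_compat|]; lra. }
    induction k as [|k IH]; [simpl; rewrite !Rmult_0_l; lra|].
    rewrite S_INR.
    pose proof (Hu (INR k * (x' / INR n)) (INR k * (y' / INR n))
       ((INR k + 1) * (x' / INR n)) ((INR k + 1) * (y' / INR n))) as H.
    replace ((INR k + 1) * (x' / INR n) - INR k * (x' / INR n)) with (x' / INR n) in H by ring.
    replace ((INR k + 1) * (y' / INR n) - INR k * (y' / INR n)) with (y' / INR n) in H by ring.
    specialize (H (Hs _ Hi) (Hs _ Hj)).
    pose proof (Rabs_triang_inv (f ((INR k + 1) * (x' / INR n)) ((INR k + 1) * (y' / INR n)))
      (f (INR k * (x' / INR n)) (INR k * (y' / INR n)))). lra. }
  specialize (Hk n).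
  replace (INR n * (x' / INR n)) with x' in Hk by (field; lra).
  replace (INR n * (y' / INR n)) with y' in Hk by (field; lra). exact Hk.
Qed.

Definition slowness (a : R -> R -> R) (z : C) : R := / a (fst z) (snd z).

Lemma slowness_facts a : admissible_coeff a ->
  exists b0 B, 0 < b0 /\ (forall z, b0 <= slowness a z <= B) /\
  (forall z i j, slowness a (z + lat i j)%C = slowness a z) /\
  (forall omega, 0 < omega -> exists rho, 0 < rho /\
     forall x y, Cmod (x - y)%C <= rho -> slowness a x <= (1 + omega) * slowness a y).
Proof.
  intros (Hc & Hpos & Hper).
  destruct (periodic2_bounded a Hc Hper) as [A HA].
  assert (Hc' : forall x y, continuity_2d_pt (fun x y => / a x y) x y).
  { intros x y; apply continuity_2d_pt_inv; auto. specialize (Hpos x y); lra. }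
  assert (Hper' : periodic2 (fun x y => / a x y)).
  { intros x y; now rewrite (proj1 (Hper x y)), (proj2 (Hper x y)). }
  destruct (periodic2_bounded _ Hc' Hper') as [B HB].
  assert (HA' : forall x y, 0 < a x y <= A).
  { intros x y; specialize (Hpos x y); specialize (HA x y); rewrite Rabs_pos_eq in HA by lra; lra. }
  assert (HA0 : 0 < A) by (specialize (HA' 0 0); lra).
  assert (Hlow : forall z, / A <= slowness a z).
  { intro z; unfold slowness; apply Rinv_le_contravar; apply HA'. }
  exists (/ A), B; split; [now apply Rinv_0_lt_compat|split; [|split]].
  - intro z; split; [auto|]. eapply Rle_trans; [apply Rle_abs|apply HB].
  - intros z i j; unfold slowness, lat; simpl; f_equal; now apply periodic2_shift.
  - intros omega Hom.
    (* An additive modulus [omega * / A] becomes multiplicative because [/ A] bounds the slowness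
       from below. *)
    assert (HoA : 0 < omega * / A) by (apply Rmult_lt_0_compat; [|apply Rinv_0_lt_compat]; auto).
    destruct (periodic2_uniformly_continuous _ Hc' Hper' _ HoA) as (rho & Hrho & Hu).
    exists (rho / 2); split; [lra|]. intros x y Hxy.
    pose proof (Rmax_Cmod (x - y)%C) as Hm.
    pose proof (Rmax_l (Rabs (fst (x - y)%C)) (Rabs (snd (x - y)%C))).
    pose proof (Rmax_r (Rabs (fst (x - y)%C)) (Rabs (snd (x - y)%C))).
    specialize (Hu (fst y) (snd y) (fst x) (snd x)).
    simpl in *. unfold Rminus in Hu. specialize (Hu ltac:(lra) ltac:(lra)).
    apply Rabs_def2 in Hu. specialize (Hlow y).
    assert (omega * / A <= omega * slowness a y) by (apply Rmult_le_compat_l; lra).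
    unfold slowness in *; lra.
Qed.

(** * Smooth subsolutions and their integrated forms *)

Definition subsol (a : R -> R -> R) (p1 p2 m : R) : Prop :=
  exists phi d1 d2, C1_periodic phi d1 d2 /\
    forall x y, a x y * norm2 (p1 + d1 x y) (p2 + d2 x y) <= m.

Lemma norm2_Cmod u v : norm2 u v = Cmod (u, v).
Proof. unfold norm2, Cmod; simpl; f_equal; ring. Qed.

Lemma derivable_pt_lim_affine (c d t : R) : derivable_pt_lim (fun t => c + t * d) t d.
Proof. apply is_derive_Reals; auto_derive; auto; ring. Qed.

(** The mean value theorem along the segment, then the Cauchy-Schwarz inequality at the intermediate
    point. *)
Lemma subsol_level a p m : admissible_coeff a -> 0 <= m -> subsol a (fst p) (snd p) m ->
  exists u, quasi p u /\ level (slowness a) m u.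
Proof.
  intros (_ & Hpos & _) Hm (phi & d1 & d2 & (Hper & Hdiff & _ & _) & Hle).
  exists (fun z => dot p z + phi (fst z) (snd z)); split.
  - intros z i j; rewrite dot_plus_r; simpl; rewrite (periodic2_shift phi Hper); ring.
  - intros z z' beta Hbeta.
    set (e := (z' - z)%C).
    set (X := fun t => fst z + t * fst e); set (Y := fun t => snd z + t * snd e).
    set (df := fun t => (fst p + d1 (X t) (Y t)) * fst e + (snd p + d2 (X t) (Y t)) * snd e).
    set (F := fun t => fst p * X t + snd p * Y t + phi (X t) (Y t)).
    assert (HX : forall t, derivable_pt_lim X t (fst e)).
    { intro t; apply derivable_pt_lim_affine. }
    assert (HY : forall t, derivable_pt_lim Y t (snd e)).
    { intro t; apply derivable_pt_lim_affine. }
    assert (HF : forall t, derivable_pt_lim F t (df t)).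
    { intro t. replace (df t) with ((fst p * fst e + snd p * snd e)
         + (d1 (X t) (Y t) * fst e + d2 (X t) (Y t) * snd e)) by (unfold df; ring).
      apply (derivable_pt_lim_plus (fun t => fst p * X t + snd p * Y t) (fun t => phi (X t) (Y t))).
      - apply (derivable_pt_lim_plus (fun t => fst p * X t) (fun t => snd p * Y t));
          apply (derivable_pt_lim_scal); auto.
      - apply derivable_pt_lim_comp_2d; auto. }
    destruct (MVT_gen F 0 1 df) as (t & Ht & E).
    + intros t _; now apply is_derive_Reals.
    + intros t _; apply derivable_continuous_pt; exists (df t); apply HF.
    + rewrite Rmin_left, Rmax_right in Ht by lra.
      assert (EF : dot p z' + phi (fst z') (snd z') - (dot p z + phi (fst z) (snd z)) = F 1 - F 0).
      { assert (X 1 = fst z') as E1 by (unfold X, e; simpl; ring).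
        assert (Y 1 = snd z') as E2 by (unfold Y, e; simpl; ring).
        assert (X 0 = fst z) as E3 by (unfold X, e; simpl; ring).
        assert (Y 0 = snd z) as E4 by (unfold Y, e; simpl; ring).
        unfold F, dot; rewrite E1, E2, E3, E4; ring. }
      rewrite EF, E.
      set (q := (fst p + d1 (X t) (Y t), snd p + d2 (X t) (Y t)) : C).
      assert (Hq : Cmod q <= m * slowness a (X t, Y t)).
      { specialize (Hle (X t) (Y t)); rewrite norm2_Cmod in Hle; fold q in Hle.
        specialize (Hpos (X t) (Y t)); unfold slowness; simpl.
        apply Rmult_le_reg_l with (a (X t) (Y t)); auto.
        replace (a (X t) (Y t) * (m * / a (X t) (Y t))) with m by (field; lra). exact Hle. }
      assert (Hb : slowness a (X t, Y t) <= beta).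
      { specialize (Hbeta t Ht). replace (X t, Y t) with (z + RtoC t * (z' - z))%C; auto.
        destruct z, z'; unfold X, Y, e, Cplus, Cmult, Cminus, Copp, RtoC; simpl; f_equal; ring. }
      replace (df t * (1 - 0)) with (dot q e) by (unfold df, dot, q; simpl; ring).
      eapply Rle_trans; [apply dot_le|]. apply Rmult_le_compat_r; [apply Cmod_ge_0|].
      eapply Rle_trans; [exact Hq|]. apply Rmult_le_compat_l; auto.
Qed.

Lemma gradient_bound f x y l1 l2 c r : 0 <= c -> 0 < r ->
  differentiable_pt_lim f x y l1 l2 ->
  (forall u v, Cmod (u, v) <= r -> f (x + u) (y + v) - f x y <= c * Cmod (u, v)) ->
  Cmod (l1, l2) <= c.
Proof.
  intros Hc Hr Hd H.
  set (G := Cmod (l1, l2)). assert (HG : 0 <= G) by apply Cmod_ge_0.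
  apply le_epsilon; intros eps Heps.
  destruct (Rle_lt_or_eq_dec 0 G HG) as [HG0|HG0]; [|lra].
  destruct (Hd (mkposreal eps Heps)) as [d Hd']; simpl in Hd'.
  (* Test in the direction of the gradient, with a displacement of length [Rmin d r / 2]: the linear
     part grows by [tau * G * G]. *)
  set (tau := Rmin d r / (2 * G)).
  assert (Hm : 0 < Rmin d r) by (apply Rmin_pos; [apply cond_pos|auto]).
  assert (Htau : 0 < tau) by (apply Rdiv_lt_0_compat; lra).
  assert (Et : tau * G = Rmin d r / 2) by (unfold tau; field; lra).
  assert (Ec : Cmod (tau * l1, tau * l2) = tau * G).
  { replace ((tau * l1, tau * l2) : C) with (RtoC tau * (l1, l2))%C
      by (unfold Cmult, RtoC; simpl; f_equal; ring).
    rewrite Cmod_mult, Cmod_R, Rabs_pos_eq by lra; reflexivity. }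
  pose proof (Rmax_Cmod (tau * l1, tau * l2)) as HR; simpl in HR; rewrite Ec in HR.
  pose proof (Rmax_l (Rabs (tau * l1)) (Rabs (tau * l2))).
  pose proof (Rmax_r (Rabs (tau * l1)) (Rabs (tau * l2))).
  pose proof (Rmin_l d r); pose proof (Rmin_r d r).
  specialize (Hd' (x + tau * l1) (y + tau * l2)).
  replace (x + tau * l1 - x) with (tau * l1) in Hd' by ring.
  replace (y + tau * l2 - y) with (tau * l2) in Hd' by ring.
  specialize (Hd' ltac:(lra) ltac:(lra)). apply Rabs_le_between in Hd'.
  specialize (H (tau * l1) (tau * l2)). rewrite Ec in H. specialize (H ltac:(lra)).
  assert (HGG : G * G = l1 * l1 + l2 * l2) by (unfold G; rewrite Cmod_sqr; reflexivity).
  assert (E : l1 * (tau * l1) + l2 * (tau * l2) = (tau * G) * G) by (rewrite Rmult_assoc, HGG; ring).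
  assert (eps * Rmax (Rabs (tau * l1)) (Rabs (tau * l2)) <= eps * (tau * G))
    by (apply Rmult_le_compat_l; lra).
  apply Rmult_le_reg_l with (tau * G); lra.
Qed.

(** Averaging the periodic part of [V] over small squares gives a [C^1] corrector. Increment bounds
    survive averaging, at the price of the factor [1 + om] by which the slowness varies on a square;
    [om = (1 - m) / 2] keeps [m * (1 + om)] below 1. *)
Lemma strict_sub_subsol a p : admissible_coeff a -> strict_sub (slowness a) p ->
  exists m, m < 1 /\ subsol a (fst p) (snd p) m.
Proof.
  intros Ha (V & m & r & Hq & Hm & Hr & HV).
  destruct (slowness_facts a Ha) as (b0 & B & Hb0 & Hb & _ & Huc).
  assert (HB : 0 < B) by (destruct (Hb (RtoC 0)); lra).
  set (om := (1 - m) / 2).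
  destruct (Huc om ltac:(unfold om; lra)) as (rho & Hrho & Hvar).
  set (h := rho / 2). assert (Hh : 0 < h) by (unfold h; lra).
  set (g := fun x y => V (x, y) - dot p (x, y)).
  assert (Hp := Cmod_ge_0 p).
  set (c := B + Cmod p). assert (Hc : 0 <= c) by (unfold c; lra).
  assert (Hg : loc_lip g c (r / 2)).
  { assert (H1 : forall z z', Cmod (z' - z)%C <= r ->
       (V z' - dot p z') - (V z - dot p z) <= c * Cmod (z' - z)%C).
    { intros z z' Hz. specialize (HV z z' Hz).
      pose proof (dot_abs_le p (z' - z)%C) as Hd; apply Rabs_le_between in Hd; rewrite dot_minus_r in Hd.
      assert (m * slowness a z * Cmod (z' - z)%C <= B * Cmod (z' - z)%C).
      { apply Rmult_le_compat_r; [apply Cmod_ge_0|]. destruct (Hb z).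
        apply Rle_trans with (1 * slowness a z); [apply Rmult_le_compat_r|]; lra. }
      unfold c; lra. }
    intros x y u v Hu Hv.
    pose proof (Cmod_le_abs ((u, v) - (x, y))%C) as H2.
    change (fst ((u, v) - (x, y))%C) with (u - x) in H2.
    change (snd ((u, v) - (x, y))%C) with (v - y) in H2.
    pose proof (H1 (x, y) (u, v) ltac:(lra)) as H3.
    pose proof (H1 (u, v) (x, y)) as H4; rewrite (Cmod_minus_sym (x, y)) in H4.
    specialize (H4 ltac:(lra)).
    pose proof (Rmult_le_compat_l c _ _ Hc H2). apply Rabs_le; unfold g; lra. }
  assert (Hgp : periodic2 g).
  { intros x y; unfold g.
    assert (E1 : ((x + 1, y) : C) = ((x, y) + lat 1 0)%C) by (unfold lat, Cplus; simpl; f_equal; ring).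
    assert (E2 : ((x, y + 1) : C) = ((x, y) + lat 0 1)%C) by (unfold lat, Cplus; simpl; f_equal; ring).
    rewrite E1, E2, !Hq, !dot_plus_r; split; ring. }
  assert (Hr2 : 0 < r / 2) by lra. assert (Hh0 : 0 <= h) by lra.
  exists (m * (1 + om)); split; [unfold om; nra|].
  set (k := / (h * h)). assert (Hk : 0 < k) by (apply Rinv_0_lt_compat; nra).
  set (phi := fun x y => k * steklov g h x y).
  assert (Hdiff : forall x y, differentiable_pt_lim phi x y (k * steklov_dx g h x y) (k * steklov_dy g h x y)).
  { intros x y eps.
    assert (He : 0 < eps / k) by (apply Rdiv_lt_0_compat; [apply cond_pos|auto]).
    destruct (steklov_differentiable g c (r / 2) h x y Hr2 Hc Hh0 Hg (mkposreal _ He)) as [d Hd].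
    exists d; intros u v Hu Hv; specialize (Hd u v Hu Hv); simpl in Hd; unfold phi.
    set (T := Rmax (Rabs (u - x)) (Rabs (v - y))) in *.
    replace (k * steklov g h u v - k * steklov g h x y
       - (k * steklov_dx g h x y * (u - x) + k * steklov_dy g h x y * (v - y)))
      with (k * (steklov g h u v - steklov g h x y
       - (steklov_dx g h x y * (u - x) + steklov_dy g h x y * (v - y)))) by ring.
    rewrite Rabs_mult, (Rabs_pos_eq k) by lra.
    replace (eps * T) with (k * (eps / k * T)) by (field; lra).
    apply Rmult_le_compat_l; lra. }
  exists phi, (fun x y => k * steklov_dx g h x y), (fun x y => k * steklov_dy g h x y); split.
  { repeat split; auto.
    - unfold phi; now rewrite (proj1 (steklov_periodic g h Hgp x y)).
    - unfold phi; now rewrite (proj2 (steklov_periodic g h Hgp x y)).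
    - intros x y; apply continuity_2d_pt_mult; [apply continuity_2d_pt_const|].
      apply (steklov_dx_continuity g c (r / 2)); auto.
    - intros x y; apply continuity_2d_pt_mult; [apply continuity_2d_pt_const|].
      apply (steklov_dy_continuity g c (r / 2)); auto. }
  intros x y; rewrite norm2_Cmod.
  set (cc := m * ((1 + om) * slowness a (x, y))).
  assert (Hbxy : 0 < slowness a (x, y)) by (destruct (Hb (x, y)); lra).
  assert (Hcc : 0 <= cc) by (unfold cc; apply Rmult_le_pos; [lra|apply Rmult_le_pos; unfold om; lra]).
  assert (HG : Cmod (fst p + k * steklov_dx g h x y, snd p + k * steklov_dy g h x y) <= cc).
  { apply (gradient_bound (fun u v => dot p (u, v) + phi u v) x y _ _ cc r); auto.
    - intros eps; destruct (Hdiff x y eps) as [d Hd]; exists d; intros u v Hu Hv.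
      specialize (Hd u v Hu Hv). unfold dot; simpl.
      match goal with |- Rabs ?A <= _ => match type of Hd with Rabs ?B <= _ =>
        replace A with B by ring end end. exact Hd.
    - intros u v Huv.
      assert (Hst : steklov g h (x + u) (y + v)
        <= steklov g h x y + h * (h * (cc * Cmod (u, v) - dot p (u, v)))).
      { apply (steklov_increment g c (r / 2)); auto. intros s t Hs Ht.
        set (z := (x + s, y + t) : C). set (z' := (x + u + s, y + v + t) : C).
        assert (Ez : (z' - z)%C = (u, v))
          by (unfold z, z', Cminus, Cplus, Copp; simpl; f_equal; ring).
        pose proof (HV z z') as H; rewrite Ez in H. specialize (H Huv).
        assert (Hz : slowness a z <= (1 + om) * slowness a (x, y)).
        { apply Hvar. eapply Rle_trans; [apply Cmod_le_abs|].
          unfold z; simpl. rewrite !Rabs_pos_eq by lra. unfold h in *; lra. }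
        assert (m * slowness a z * Cmod (u, v) <= cc * Cmod (u, v)).
        { apply Rmult_le_compat_r; [apply Cmod_ge_0|]. unfold cc; apply Rmult_le_compat_l; lra. }
        unfold g; fold z z'.
        assert (dot p z' = dot p z + dot p (u, v)) by (rewrite <- Ez, dot_minus_r; ring).
        lra. }
      apply (Rmult_le_compat_l k) in Hst; [|lra].
      assert (E : k * (steklov g h x y + h * (h * (cc * Cmod (u, v) - dot p (u, v))))
         = k * steklov g h x y + (cc * Cmod (u, v) - dot p (u, v))) by (unfold k; field; lra).
      rewrite E in Hst. unfold phi.
      assert (dot p (x + u, y + v) = dot p (x, y) + dot p (u, v)) by (unfold dot; simpl; ring).
      lra. }
  destruct Ha as (_ & Hpos & _). specialize (Hpos x y).
  apply (Rmult_le_compat_l (a x y)) in HG; [|lra].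
  eapply Rle_trans; [exact HG|]. right; unfold cc, slowness; simpl; field; lra.
Qed.

(** * The effective Hamiltonian on the boundary of its sublevel set *)

Lemma effH_finite a p1 p2 : admissible_coeff a ->
  is_glb_Rbar (subsol a p1 p2) (Finite (effH a p1 p2)).
Proof.
  intros (Hc & Hpos & Hper).
  pose proof (Glb_Rbar_correct (subsol a p1 p2)) as HG.
  unfold effH; change (fun m : R => _) with (subsol a p1 p2).
  (* [real] would turn an infinite bound into 0. The zero corrector excludes plus infinity, and the
     lower bound 0 excludes minus infinity. *)
  destruct (Glb_Rbar (subsol a p1 p2)) as [g| |]; simpl; auto; exfalso.
  - destruct (periodic2_bounded a Hc Hper) as [A HA].
    assert (Hs : subsol a p1 p2 (A * norm2 p1 p2)).
    { exists (fun _ _ => 0), (fun _ _ => 0), (fun _ _ => 0); split.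
      - repeat split; try (intros; apply continuity_2d_pt_const).
        intros x y eps; exists (mkposreal 1 Rlt_0_1); intros u v _ _.
        rewrite !Rmult_0_l, Rplus_0_r, !Rminus_0_r, Rabs_R0.
        apply Rmult_le_pos; [left; apply cond_pos|]. eapply Rle_trans; [apply Rabs_pos|apply Rmax_l].
      - intros x y; rewrite !Rplus_0_r. apply Rmult_le_compat_r; [apply sqrt_pos|].
        eapply Rle_trans; [apply Rle_abs|apply HA]. }
    exact (proj1 HG _ Hs).
  - apply (proj2 HG 0). intros m (phi & d1 & d2 & _ & Hm); simpl.
    eapply Rle_trans; [|apply (Hm 0 0)]. apply Rmult_le_pos; [left; apply Hpos|apply sqrt_pos].
Qed.

Lemma effH_le_subsol a p1 p2 m : admissible_coeff a -> effH a p1 p2 < m -> subsol a p1 p2 m.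
Proof.
  intros Ha H. apply NNPP; intro Hno.
  assert (Hlb : is_lb_Rbar (subsol a p1 p2) m).
  { intros m' Hm'; simpl; apply Rnot_lt_le; intro Hlt; apply Hno.
    destruct Hm' as (phi & d1 & d2 & H1 & H2); exists phi, d1, d2; split; auto.
    intros x y; specialize (H2 x y); lra. }
  pose proof (proj2 (effH_finite a p1 p2 Ha) _ Hlb) as H'; simpl in H'; lra.
Qed.

Lemma subsol_effH_le a p1 p2 m : admissible_coeff a -> subsol a p1 p2 m -> effH a p1 p2 <= m.
Proof. intros Ha H; exact (proj1 (effH_finite a p1 p2 Ha) _ H). Qed.

Lemma subsol_perturb a A p1 p2 q1 q2 m : (forall x y, 0 < a x y <= A) ->
  subsol a q1 q2 m -> subsol a p1 p2 (m + A * norm2 (q1 - p1) (q2 - p2)).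
Proof.
  intros HA (phi & d1 & d2 & H1 & H2); exists phi, d1, d2; split; auto.
  intros x y; specialize (H2 x y); specialize (HA x y); rewrite !norm2_Cmod in *.
  set (P := (p1 + d1 x y, p2 + d2 x y) : C); set (Q := (q1 + d1 x y, q2 + d2 x y) : C) in *.
  pose proof (Cmod_triangle (P - Q) Q) as H.
  replace (P - Q + Q)%C with P in H by ring.
  rewrite Cmod_minus_sym in H.
  replace (Q - P)%C with ((q1 - p1, q2 - p2) : C) in H
    by (unfold P, Q, Cminus, Cplus, Copp; simpl; f_equal; ring).
  set (D := Cmod (q1 - p1, q2 - p2)) in *.
  assert (0 <= D) by apply Cmod_ge_0.
  assert (a x y * D <= A * D) by (apply Rmult_le_compat_r; lra).
  apply (Rmult_le_compat_l (a x y)) in H; [|lra]. lra.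
Qed.

(** [subsol_perturb] makes [effH] Lipschitz in [p], so it equals 1 on the boundary. Strict
    inequalities in [m] are used because the infimum need not be attained. *)
Lemma boundary_subsol a p1 p2 : admissible_coeff a -> in_boundary (S_a a) p1 p2 ->
  (forall m, 1 < m -> subsol a p1 p2 m) /\ (forall m, m < 1 -> ~ subsol a p1 p2 m).
Proof.
  intros Ha Hbd.
  assert (HA : exists A, 0 < A /\ forall x y, 0 < a x y <= A).
  { destruct Ha as (Hc & Hpos & Hper). destruct (periodic2_bounded a Hc Hper) as [A HA].
    exists A; assert (H : forall x y, 0 < a x y <= A).
    { intros x y; split; auto; eapply Rle_trans; [apply Rle_abs|apply HA]. }
    split; auto. specialize (H 0 0); lra. }
  destruct HA as (A & HA0 & HA).
  split; intros m Hm.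
  - set (eps := (m - 1) / (2 * A)).
    assert (Heps : 0 < eps) by (apply Rdiv_lt_0_compat; lra).
    destruct (Hbd eps Heps) as [(q1 & q2 & Hq & Hd) _].
    assert (Hs : subsol a q1 q2 ((m + 1) / 2)) by (apply effH_le_subsol; auto; unfold S_a in Hq; lra).
    apply (subsol_perturb a A p1 p2) in Hs; auto.
    destruct Hs as (phi & d1 & d2 & H1 & H2); exists phi, d1, d2; split; auto.
    intros x y; eapply Rle_trans; [apply H2|].
    assert (A * norm2 (q1 - p1) (q2 - p2) <= A * eps) by (apply Rmult_le_compat_l; lra).
    assert (A * eps = (m - 1) / 2) by (unfold eps; field; lra). lra.
  - intro Hs. set (eps := (1 - m) / A).
    assert (Heps : 0 < eps) by (apply Rdiv_lt_0_compat; lra).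
    destruct (Hbd eps Heps) as [_ (q1 & q2 & Hq & Hd)]. apply Hq; unfold S_a.
    apply (subsol_perturb a A q1 q2) in Hs; auto. apply subsol_effH_le in Hs; auto.
    replace (norm2 (p1 - q1) (p2 - q2)) with (norm2 (q1 - p1) (q2 - p2)) in Hs
      by (unfold norm2; f_equal; ring).
    assert (A * norm2 (q1 - p1) (q2 - p2) <= A * eps) by (apply Rmult_le_compat_l; lra).
    assert (A * eps = 1 - m) by (unfold eps; field; lra). lra.
Qed.

Lemma subsol_scale a p1 p2 m l : 0 <= l -> subsol a p1 p2 m -> subsol a (l * p1) (l * p2) (l * m).
Proof.
  intros Hl (phi & d1 & d2 & (Hp & Hd & Hc1 & Hc2) & H).
  exists (fun x y => l * phi x y), (fun x y => l * d1 x y), (fun x y => l * d2 x y); split.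
  - repeat split.
    + now rewrite (proj1 (Hp x y)).
    + now rewrite (proj2 (Hp x y)).
    + intros x y eps.
      (* Dividing by [l + 1] also covers [l = 0]. *)
      assert (He : 0 < eps / (l + 1)) by (apply Rdiv_lt_0_compat; [apply cond_pos|lra]).
      destruct (Hd x y (mkposreal _ He)) as [d Hd']; exists d; intros u v Hu Hv.
      specialize (Hd' u v Hu Hv); simpl in Hd'.
      set (T := Rmax (Rabs (u - x)) (Rabs (v - y))) in *.
      assert (HT : 0 <= T) by (eapply Rle_trans; [apply Rabs_pos|apply Rmax_l]).
      replace (l * phi u v - l * phi x y - (l * d1 x y * (u - x) + l * d2 x y * (v - y)))
        with (l * (phi u v - phi x y - (d1 x y * (u - x) + d2 x y * (v - y)))) by ring.
      rewrite Rabs_mult, (Rabs_pos_eq l) by lra.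
      apply Rle_trans with (l * (eps / (l + 1) * T)); [apply Rmult_le_compat_l; lra|].
      replace (eps * T) with ((l + 1) * (eps / (l + 1) * T)) by (field; lra).
      apply Rmult_le_compat_r; [apply Rmult_le_pos|]; lra.
    + intros x y; apply continuity_2d_pt_mult; auto; apply continuity_2d_pt_const.
    + intros x y; apply continuity_2d_pt_mult; auto; apply continuity_2d_pt_const.
  - intros x y; specialize (H x y); rewrite !norm2_Cmod in *.
    set (P := (p1 + d1 x y, p2 + d2 x y) : C) in *.
    replace ((l * p1 + l * d1 x y, l * p2 + l * d2 x y) : C) with (RtoC l * P)%C
      by (unfold P, Cmult, RtoC; simpl; f_equal; ring).
    rewrite Cmod_mult, Cmod_R, Rabs_pos_eq by lra.
    apply (Rmult_le_compat_l l) in H; lra.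
Qed.

(* Otherwise the segment would lie on a line through the origin, along which [effH] is
   not constant by homogeneity. *)
Lemma segment_transversal a x1 x2 v1 v2 : admissible_coeff a -> v1 <> 0 \/ v2 <> 0 ->
  (forall t, 0 <= t <= 1 -> in_boundary (S_a a) (x1 + t * v1) (x2 + t * v2)) ->
  (x1 + 1 / 2 * v1) * v2 - (x2 + 1 / 2 * v2) * v1 <> 0.
Proof.
  intros Ha Hv Hseg Hdet.
  set (p1 := x1 + 1 / 2 * v1) in *; set (p2 := x2 + 1 / 2 * v2) in *.
  assert (Hnv : 0 < v1 * v1 + v2 * v2).
  { destruct Hv as [H|H]; pose proof (Rlt_0_sqr _ H) as Hs; unfold Rsqr in Hs;
      [pose proof (Rle_0_sqr v2) as Hs'|pose proof (Rle_0_sqr v1) as Hs']; unfold Rsqr in Hs'; lra. }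
  set (c := (p1 * v1 + p2 * v2) / (v1 * v1 + v2 * v2)).
  assert (E1 : p1 = c * v1).
  { apply Rmult_eq_reg_r with (v1 * v1 + v2 * v2); [|lra].
    unfold c; field_simplify; [|lra].
    replace (p1 * v1 ^ 2 + p1 * v2 ^ 2) with (p1 * v1 ^ 2 + (p1 * v2) * v2) by ring.
    replace (p1 * v2) with (p2 * v1) by lra. ring. }
  assert (E2 : p2 = c * v2).
  { apply Rmult_eq_reg_r with (v1 * v1 + v2 * v2); [|lra].
    unfold c; field_simplify; [|lra].
    replace (p2 * v1 ^ 2 + p2 * v2 ^ 2) with ((p2 * v1) * v1 + p2 * v2 ^ 2) by ring.
    replace (p2 * v1) with (p1 * v2) by lra. ring. }
  assert (Hmid : forall m, m < 1 -> ~ subsol a p1 p2 m)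
    by (apply boundary_subsol; auto; apply (Hseg (1 / 2)); lra).
  (* The midpoint is [c * v]; the end of the segment on the side of the sign of [c] is farther from
     the origin, so the midpoint is that end shrunk by a factor [l < 1]. *)
  assert (Hend : exists t l, 0 <= t <= 1 /\ 0 <= l < 1 /\
      p1 = l * (x1 + t * v1) /\ p2 = l * (x2 + t * v2)).
  { destruct (Rle_dec 0 c) as [Hc|Hc].
    - exists 1, (c / (c + 1 / 2)).
      assert (x1 + 1 * v1 = (c + 1 / 2) * v1) as -> by (unfold p1 in E1; lra).
      assert (x2 + 1 * v2 = (c + 1 / 2) * v2) as -> by (unfold p2 in E2; lra).
      repeat split; try lra.
      + apply Rle_mult_inv_pos; lra.
      + apply Rmult_lt_reg_r with (c + 1 / 2); [lra|]. unfold Rdiv at 1; rewrite Rmult_assoc, Rinv_l; lra.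
      + rewrite E1 at 1; field; lra.
      + rewrite E2 at 1; field; lra.
    - exists 0, (- c / (1 / 2 - c)).
      assert (x1 + 0 * v1 = (c - 1 / 2) * v1) as -> by (unfold p1 in E1; lra).
      assert (x2 + 0 * v2 = (c - 1 / 2) * v2) as -> by (unfold p2 in E2; lra).
      repeat split; try lra.
      + apply Rle_mult_inv_pos; lra.
      + apply Rmult_lt_reg_r with (1 / 2 - c); [lra|]. unfold Rdiv at 1; rewrite Rmult_assoc, Rinv_l; lra.
      + rewrite E1 at 1; field; lra.
      + rewrite E2 at 1; field; lra. }
  destruct Hend as (t & l & Ht & Hl & F1 & F2).
  (* This level exceeds 1, while its product with [l] stays below 1. *)
  assert (Hm : 1 < 2 / (1 + l)).
  { apply Rmult_lt_reg_r with (1 + l); [lra|]. unfold Rdiv; rewrite Rmult_assoc, Rinv_l; lra. }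
  pose proof (proj1 (boundary_subsol a _ _ Ha (Hseg t Ht)) _ Hm) as Hs.
  apply (subsol_scale _ _ _ _ l) in Hs; [|lra]. rewrite <- F1, <- F2 in Hs.
  apply Hmid in Hs; auto.
  apply Rmult_lt_reg_r with (1 + l); [lra|]. unfold Rdiv; rewrite !Rmult_assoc, Rinv_l; lra.
Qed.

(* For every a in C(T^2,(0,oo)), the boundary of S_a contains no line segment
   [x, x + v] with direction v of irrational slope. *)
Theorem theorem1p1 (a : R -> R -> R) (Ha : admissible_coeff a) :
  forall x1 x2 v1 v2 : R, irrational_dir v1 v2 ->
    ~ (forall t, 0 <= t <= 1 -> in_boundary (S_a a) (x1 + t * v1) (x2 + t * v2)).
Proof.
  intros x1 x2 v1 v2 Hirr Hseg.
  destruct (slowness_facts a Ha) as (b0 & B & Hb0 & Hb & Hper & Huc).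
  assert (Hv : v1 <> 0 \/ v2 <> 0).
  { apply NNPP; intro H; apply Hirr; exists 0, 0%Z, 0%Z; lra. }
  assert (Hlev : forall t, 0 <= t <= 1 -> forall m, 1 < m ->
     exists u, quasi (x1 + t * v1, x2 + t * v2) u /\ level (slowness a) m u).
  { intros t Ht m Hm; apply subsol_level; auto; [lra|].
    now apply (boundary_subsol a _ _ Ha (Hseg t Ht)). }
  set (q0 := (x1 + 0 * v1, x2 + 0 * v2) : C); set (q1 := (x1 + 1 * v1, x2 + 1 * v2) : C).
  assert (Ep : (RtoC (1 / 2) * (q0 + q1))%C = (x1 + 1 / 2 * v1, x2 + 1 / 2 * v2)).
  { unfold q0, q1, Cmult, Cplus, RtoC; simpl; f_equal; field. }
  assert (Ev : (q1 - q0)%C = (v1, v2)).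
  { unfold q0, q1, Cminus, Cplus, Copp; simpl; f_equal; ring. }
  apply (no_flat_irrational (slowness a) b0 B q0 q1); auto; rewrite ?Ep, ?Ev; simpl; auto.
  - now apply (segment_transversal a).
  - apply Hlev; lra.
  - apply Hlev; lra.
  (* A strict discrete subsolution at the midpoint would smooth to a level below 1, impossible on
     the boundary. *)
  - intro Hst; destruct (strict_sub_subsol a _ Ha Hst) as (m & Hm & Hs).
    revert Hs; apply (boundary_subsol a _ _ Ha (Hseg (1 / 2) ltac:(lra))); auto.
Qed.
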